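(* Let $\mathfrak{X}$ be an abstract state space, $(\mathcal{U}(t))_{t\ge0}$ a substochastic $C_0$-semigroup on $\mathfrak{X}$ with generator $\mathcal{A}$, $\mathcal{B}:\mathscr{D}(\mathcal{A})\to\mathfrak{X}$ a positive linear operator with $\langle\mathbf{\Psi},(\mathcal{A}+\mathcal{B})u\rangle\le0$ for all $u\in\mathscr{D}(\mathcal{A})\cap\mathfrak{X}_+$, and let $(\mathcal{V}_n(t))_{t\ge0}$, $n\ge0$, be the associated Dyson–Phillips iterates. For any integer $n\ge1$: (1) For any $u\in\mathscr{D}(\mathcal{A})$, the mapping $t\in(0,\infty)\mapsto\mathcal{V}_n(t)u$ is continuously differentiable with $\frac{\mathrm{d}}{\mathrm{d}t}\mathcal{V}_n(t)u=\mathcal{V}_n(t)\mathcal{A}u+\mathcal{V}_{n-1}(t)\mathcal{B}u$. (2) For any $u\in\mathscr{D}(\mathcal{A})$, $\mathcal{V}_n(t)u\in\mathscr{D}(\mathcal{A})$, the mapping $t\in(0,\infty)\mapsto\mathcal{A}\mathcal{V}_n(t)u$ is continuous and $\mathcal{A}\mathcal{V}_n(t)u=\mathcal{V}_n(t)\mathcal{A}u+\mathcal{V}_{n-1}(t)\mathcal{B}u-\mathcal{B}\mathcal{V}_{n-1}(t)u$. (3) For any $u\in\mathfrak{X}$ and $t\ge0$, $\int_0^t\mathcal{V}_n(s)u\,\mathrm{d}s\in\mathscr{D}(\mathcal{A})$, the mapping $t\in(0,\infty)\mapsto\mathcal{A}\int_0^t\mathcal{V}_n(s)u\,\mathrm{d}s$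 is continuous, and $$\mathcal{A}\int_0^t\mathcal{V}_n(s)u\,\mathrm{d}s=\mathcal{V}_n(t)u-\mathcal{B}\int_0^t\mathcal{V}_{n-1}(s)u\,\mathrm{d}s.$$ (4) For any $u\in\mathfrak{X}_+$ and $t\ge0$, $$\Big\langle\mathbf{\Psi},\mathcal{B}\int_0^t\mathcal{V}_n(s)u\,\mathrm{d}s\Big\rangle\le-\langle\mathbf{\Psi},\mathcal{V}_n(t)u\rangle+\Big\langle\mathbf{\Psi},\mathcal{B}\int_0^t\mathcal{V}_{n-1}(s)u\,\mathrm{d}s\Big\rangle.$$ (5) For any $u\in\mathfrak{X}$ and $\lambda>0$, the limit $\lim_{t\to\infty}\int_0^t\exp(-\lambda s)\mathcal{V}_n(s)u\,\mathrm{d}s=:\int_0^\infty\exp(-\lambda s)\mathcal{V}_n(s)u\,\mathrm{d}s$ exists in the graph norm of $\mathcal{A}$ and $$(\lambda-\mathcal{A})\int_0^\infty\exp(-\lambda s)\mathcal{V}_n(s)u\,\mathrm{d}s=\mathcal{B}\int_0^\infty\exp(-\lambda s)\mathcal{V}_{n-1}(s)u\,\mathrm{d}s.$$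
   Context: An abstract state space is a real ordered Banach space $\mathfrak{X}$ whose positive cone $\mathfrak{X}_+$ is closed, generating ($\mathfrak{X}=\mathfrak{X}_+-\mathfrak{X}_+$), and on which the norm is additive: $\|u+v\|=\|u\|+\|v\|$ for $u,v\in\mathfrak{X}_+$. $\mathbf{\Psi}\in\mathfrak{X}^\star_+$ is the positive functional with $\langle\mathbf{\Psi},u\rangle=\|u\|$ for $u\in\mathfrak{X}_+$. A linear operator is positive if it maps positive elements of its domain into $\mathfrak{X}_+$. A $C_0$-semigroup $(T(t))_{t\ge0}$ is substochastic if each $T(t)$ is positive and $\|T(t)u\|\le\|u\|$ for $u\in\mathfrak{X}_+$. Dyson–Phillips iterates: $\mathcal{V}_0(t)=\mathcal{U}(t)$, and $\mathcal{V}_{n+1}(t)$ is the unique bounded (positive) operator on $\mathfrak{X}$ with $\mathcal{V}_{n+1}(t)u=\int_0^t\mathcal{V}_n(t-s)\mathcal{B}\,\mathcal{U}(s)u\,\mathrm{d}s$ for $u\in\mathscr{D}(\mathcal{A})$, $t\ge0$, $n\ge0$; each $t\mapsto\mathcal{V}_n(t)$ is strongly continuous and bounded on $[0,\infty)$. *)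

(* Defs.v *)
From Stdlib Require Import Reals.
From Coquelicot Require Import Coquelicot.

Local Open Scope R_scope.

(** The order of the space is given by its positive cone [pos]:
    [u <= v] iff [pos (minus v u)]. *)
Record abstract_state_space (X : CompleteNormedModule R_AbsRing)
    (pos : X -> Prop) : Prop := {
  pos_zero : pos zero;
  pos_plus : forall u v : X, pos u -> pos v -> pos (plus u v);
  pos_scal : forall (a : R) (u : X), 0 <= a -> pos u -> pos (scal a u);
  pos_proper : forall u : X, pos u -> pos (opp u) -> u = zero;
  pos_closed : closed pos;
  pos_generating : forall u : X,
    exists v w : X, pos v /\ pos w /\ u = minus v w;
  norm_additive : forall u v : X,
    pos u -> pos v -> norm (plus u v) = norm u + norm v
}.

(** [is_linear] includes boundedness.  Since the cone is generating, at most one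
    functional satisfies this; it is positive because norms are. *)
Definition norm_functional (X : CompleteNormedModule R_AbsRing)
    (pos : X -> Prop) (Psi : X -> R) : Prop :=
  is_linear Psi /\ forall u : X, pos u -> Psi u = norm u.

(** Operator families indexed by [t >= 0] are total functions of [t : R]; their
    values at negative times are unconstrained and never used. *)
Record C0_semigroup (X : CompleteNormedModule R_AbsRing)
    (U : R -> X -> X) : Prop := {
  sg_bounded : forall t : R, 0 <= t -> is_linear (U t);
  sg_zero : forall u : X, U 0 u = u;
  sg_plus : forall (s t : R) (u : X),
    0 <= s -> 0 <= t -> U (s + t) u = U s (U t u);
  sg_continuous : forall u : X,
    filterlim (fun t : R => U t u) (at_right 0) (locally u)
}.

Definition substochastic (X : CompleteNormedModule R_AbsRing)
    (pos : X -> Prop) (U : R -> X -> X) : Prop :=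
  forall (t : R) (u : X),
    0 <= t -> pos u -> pos (U t u) /\ norm (U t u) <= norm u.

(** An unbounded operator is a domain together with a total function, of which
    only the values on the domain are meaningful. *)
Definition is_generator (X : CompleteNormedModule R_AbsRing)
    (U : R -> X -> X) (DA : X -> Prop) (A : X -> X) : Prop :=
  let quotient (u : X) (t : R) : X := scal (/ t) (minus (U t u) u) in
  (forall u : X,
     DA u <-> exists v : X, filterlim (quotient u) (at_right 0) (locally v)) /\
  (forall u : X, DA u -> filterlim (quotient u) (at_right 0) (locally (A u))).

Definition linear_on (X : CompleteNormedModule R_AbsRing)
    (D : X -> Prop) (B : X -> X) : Prop :=
  (forall u v : X, D u -> D v -> B (plus u v) = plus (B u) (B v)) /\
  (forall (a : R) (u : X), D u -> B (scal a u) = scal a (B u)).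

Definition positive_on (X : CompleteNormedModule R_AbsRing)
    (pos D : X -> Prop) (B : X -> X) : Prop :=
  forall u : X, D u -> pos u -> pos (B u).

(** As [DA] is dense, a bounded operator [V (S n) t] is determined by the integral
    formula on [DA]. *)
Record Dyson_Phillips (X : CompleteNormedModule R_AbsRing)
    (U : R -> X -> X) (DA : X -> Prop) (B : X -> X)
    (V : nat -> R -> X -> X) : Prop := {
  DP_zero : forall (t : R) (u : X), 0 <= t -> V 0%nat t u = U t u;
  DP_bounded : forall (n : nat) (t : R), 0 <= t -> is_linear (V n t);
  DP_succ : forall (n : nat) (t : R) (u : X), 0 <= t -> DA u ->
    is_RInt (fun s : R => V n (t - s) (B (U s u))) 0 t (V (S n) t u)
}.

(** [RInt] is a total function, so that "the integral belongs to the domain"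
    has to include the existence of the integral. *)
Definition integral_in (X : CompleteNormedModule R_AbsRing)
    (D : X -> Prop) (f : R -> X) (a b : R) : Prop :=
  ex_RInt f a b /\ D (RInt f a b).

Definition graph_norm (X : CompleteNormedModule R_AbsRing)
    (A : X -> X) (u : X) : R :=
  norm u + norm (A u).

(** The integral of [f] over [0, t] converges to [l] in the space [DA] endowed
    with the graph norm of [A], as [t] tends to infinity. *)
Definition is_graph_integral (X : CompleteNormedModule R_AbsRing)
    (DA : X -> Prop) (A : X -> X) (f : R -> X) (l : X) : Prop :=
  (forall t : R, 0 <= t -> integral_in X DA f 0 t) /\
  DA l /\
  is_lim (fun t : R => graph_norm X A (minus (RInt f 0 t) l)) p_infty 0.

(* Main.v *)
Require Import Defs.
From Stdlib Require Import Reals Lra Lia List ClassicalEpsilon.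
From Coquelicot Require Import Coquelicot.

(** The formal power series [\sum_n z^n V n t] satisfies the semigroup law, i.e.
    [V n (t + h) = \sum_(k <= n) V k t o V (n - k) h], and its generator is
    [A + z B]: for [v] in the domain of [A], the difference quotient of [V (S k)]
    at time 0 tends to [B v] if [k = 0] and to 0 if [k > 0].  Hence for a sequence
    [w] of vectors such that [\sum_(k <= n) V k h (w (n - k))] has right derivative
    [y n] at [h = 0] for every [n], each [w n] lies in the domain and
    [A (w (S n)) + B (w n) = y (S n)].  The choices [w n = V n t u],
    [w n = \int_0^t V n s u ds] and [w n = \int_0^T e^(-lambda s) V n s u ds], with
    [T] finite or infinite, give all the identities of the theorem.

    Uniform bounds come from two facts: a closed generating cone decomposes vectors
    boundedly (by Baire's theorem), and [B] is bounded relatively to [A] because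
    [|B w| = Psi (B w) <= - Psi (A w)] for positive [w]. *)

Local Open Scope R_scope.

(** * Linear identities in a real module *)

(** [B] is controlled only in the graph norm of [A], and an orbit [V n s u] of a general [u] need
    not lie in the domain, so [B] cannot be pulled out of [\int_0^t V n s u ds]. This is why [A] is
    computed from the semigroup law: in the sum [\sum_(k <= n + 1) V k h (w (n + 1 - k))] all terms
    but [k = 0] act on vectors already known to lie in the domain, so the limit of the difference
    quotient of [U] at [w (n + 1)] is what remains. Domain membership and the value of [A] come
    together, and [B] is only ever applied to vectors of the domain.

    Positivity, uniform bounds and strong continuity of the iterates are not fields of
    [Dyson_Phillips] and are derived by induction. The key is
    [\int_0^t |B (U s u)| ds <= |u| - |U t u|] for positive [u] in the domain. Since contractivity
    is a statement about the cone, bounds on the whole space carry the constant of the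
    decomposition.

    Moduli of continuity are kept uniform in [t], because a left increment at [t] is a right
    increment at an earlier, moving time. *)

Inductive lexpr : Type :=
| LVar : nat -> lexpr
| LZero : lexpr
| LPlus : lexpr -> lexpr -> lexpr
| LOpp : lexpr -> lexpr
| LScal : R -> lexpr -> lexpr.

Fixpoint leval (X : ModuleSpace R_Ring) (env : list X) (e : lexpr) : X :=
  match e with
  | LVar i => nth i env zero
  | LZero => zero
  | LPlus a b => plus (leval X env a) (leval X env b)
  | LOpp a => opp (leval X env a)
  | LScal r a => scal r (leval X env a)
  end.

Fixpoint lcoef (i : nat) (e : lexpr) : R :=
  match e with
  | LVar j => if Nat.eqb i j then 1 else 0
  | LZero => 0
  | LPlus a b => lcoef i a + lcoef i b
  | LOpp a => - lcoef i a
  | LScal r a => r * lcoef i a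
  end.

Fixpoint lcomb (X : ModuleSpace R_Ring) (env : list X) (c : nat -> R) : X :=
  match env with
  | nil => zero
  | cons x env' => plus (scal (c 0%nat) x) (lcomb X env' (fun i => c (S i)))
  end.

Lemma lcomb_zero (X : ModuleSpace R_Ring) (env : list X) :
  lcomb X env (fun _ => 0) = zero.
Proof.
  induction env as [|x env IH]; simpl; [reflexivity|].
  rewrite IH, plus_zero_r. exact (scal_zero_l x).
Qed.

Lemma lcomb_plus (X : ModuleSpace R_Ring) (env : list X) : forall c d : nat -> R,
  lcomb X env (fun i => c i + d i) = plus (lcomb X env c) (lcomb X env d).
Proof.
  induction env as [|x env IH]; intros c d; simpl.
  - now rewrite plus_zero_r.
  - rewrite (IH (fun i => c (S i)) (fun i => d (S i))).
    change (c 0%nat + d 0%nat) with (plus (c 0%nat) (d 0%nat)).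
    rewrite (scal_distr_r (c 0%nat : R_Ring)).
    rewrite <- !plus_assoc. f_equal.
    rewrite !plus_assoc. f_equal. apply plus_comm.
Qed.

Lemma lcomb_scal (X : ModuleSpace R_Ring) (env : list X) (r : R) :
  forall c : nat -> R,
  lcomb X env (fun i => r * c i) = scal r (lcomb X env c).
Proof.
  induction env as [|x env IH]; intros c; simpl.
  - now rewrite (scal_zero_r (r : R_Ring)).
  - rewrite (IH (fun i => c (S i))), (scal_distr_l (r : R_Ring)).
    f_equal. symmetry. exact (scal_assoc (r : R_Ring) _ x).
Qed.

Lemma lcomb_var (X : ModuleSpace R_Ring) (env : list X) : forall j : nat,
  lcomb X env (fun i => if Nat.eqb i j then 1 else 0) = nth j env zero.
Proof.
  induction env as [|x env IH]; intros j; simpl.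
  - now destruct j.
  - destruct j as [|j]; simpl.
    + rewrite lcomb_zero, plus_zero_r. exact (scal_one x).
    + rewrite IH.
      replace (scal 0 x) with (@zero X) by (symmetry; exact (scal_zero_l x)).
      apply plus_zero_l.
Qed.

Lemma lcomb_ext (X : ModuleSpace R_Ring) (env : list X) : forall c d : nat -> R,
  (forall i, (i < length env)%nat -> c i = d i) -> lcomb X env c = lcomb X env d.
Proof.
  induction env as [|x env IH]; intros c d H; simpl; [reflexivity|].
  rewrite (H 0%nat) by (simpl; lia). f_equal.
  apply IH. intros i Hi. apply H. simpl. lia.
Qed.

Lemma leval_lcomb (X : ModuleSpace R_Ring) (env : list X) (e : lexpr) :
  leval X env e = lcomb X env (fun i => lcoef i e).
Proof.
  induction e as [j| |a IHa b IHb|a IHa|r a IHa]; simpl.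
  - symmetry. apply lcomb_var.
  - symmetry. apply lcomb_zero.
  - now rewrite lcomb_plus, IHa, IHb.
  - rewrite IHa, <- (scal_opp_one (K := R_Ring)).
    etransitivity; [symmetry; exact (lcomb_scal X env (-1) _)|].
    apply lcomb_ext. intros. ring.
  - now rewrite lcomb_scal, IHa.
Qed.

(** Soundness of the reflection: a vector identity becomes one scalar identity per atom, within
    reach of [ring] or [field]. Indices beyond the environment need no check, as [nth] returns
    [zero] there. *)
Lemma leval_eq (X : ModuleSpace R_Ring) (env : list X) (e1 e2 : lexpr) :
  (forall i, (i < length env)%nat -> lcoef i e1 = lcoef i e2) ->
  leval X env e1 = leval X env e2.
Proof. intros H. rewrite !leval_lcomb. now apply lcomb_ext. Qed.

Ltac vec_index x env :=
  lazymatch env with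
  | cons x _ => constr:(O)
  | cons _ ?env' => let n := vec_index x env' in constr:(S n)
  end.

Ltac vec_atoms t env :=
  lazymatch t with
  | plus ?a ?b => let env := vec_atoms a env in vec_atoms b env
  | minus ?a ?b => let env := vec_atoms a env in vec_atoms b env
  | opp ?a => vec_atoms a env
  | scal _ ?a => vec_atoms a env
  | zero => env
  (* A non-lazy [match]: when [vec_index] fails, the second branch records [t] as a new atom. *)
  | _ => match env with
         | _ => let n := vec_index t env in env
         | _ => constr:(cons t env)
         end
  end.

Ltac vec_reify t env :=
  lazymatch t with
  | plus ?a ?b =>
      let a := vec_reify a env in let b := vec_reify b env in constr:(LPlus a b)
  | minus ?a ?b =>
      let a := vec_reify a env in let b := vec_reify b env in
      constr:(LPlus a (LOpp b))
  | opp ?a => let a := vec_reify a env in constr:(LOpp a)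
  | scal ?r ?a => let a := vec_reify a env in constr:(LScal r a)
  | zero => constr:(LZero)
  | _ => let n := vec_index t env in constr:(LVar n)
  end.

(** The environment is a concrete list, so the bounded quantifier over indices unfolds into finitely
    many scalar goals. *)
Ltac vec_coef :=
  repeat match goal with
  | |- forall i, (i < S _)%nat -> _ => intros [|?]; [intros _|]
  | |- forall i, (i < O)%nat -> _ => intros ? ?; exfalso; eapply Nat.nlt_0_r; eassumption
  | |- (S ?n < S _)%nat -> _ =>
      let H := fresh in intros H; apply Nat.succ_lt_mono in H; revert H; revert n
  end.

Ltac vec_in X :=
  lazymatch goal with
  | |- ?l = ?r =>
      let env := vec_atoms l (@nil (ModuleSpace.sort R_Ring X)) in
      let env := vec_atoms r env in
      let l' := vec_reify l env in
      let r' := vec_reify r env in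
      change (leval X env l' = leval X env r');
      apply leval_eq; cbn [length]; vec_coef; cbn [lcoef Nat.eqb]; try ring
  end.

(* [vec] compares the coefficients of each atom, leaving to the user those that
   [ring] does not identify. *)
Ltac vec :=
  match goal with
  | X : CompleteNormedModule.type R_AbsRing |- _ =>
      vec_in (CompleteNormedModule.ModuleSpace R_AbsRing X)
  end.

(** * Norms and limits *)

(* Coquelicot's structures reach the same operation along several coercion paths,
   which [lra] takes for different atoms. *)
Ltac canonical_paths :=
  match goal with
  | X : CompleteNormedModule.type R_AbsRing |- _ =>
      let G := constr:(CompleteNormedModule.AbelianGroup R_AbsRing X) in
      let H := constr:(CompleteNormedModule.AbelianMonoid R_AbsRing X) in
      repeat match goal with
      | |- context [@minus ?G' ?a ?b] =>
          lazymatch G' with G => fail | _ => change (@minus G' a b) with (@minus G a b) end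
      | |- context [@plus ?G' ?a ?b] =>
          lazymatch G' with H => fail | R_AbelianMonoid => fail
          | _ => change (@plus G' a b) with (@plus H a b) end
      | |- context [@sum_n ?G' ?a ?b] =>
          lazymatch G' with H => fail | _ => change (@sum_n G' a b) with (@sum_n H a b) end
      | h : context [@minus ?G' ?a ?b] |- _ =>
          lazymatch G' with G => fail
          | _ => change (@minus G' a b) with (@minus G a b) in h end
      | h : context [@plus ?G' ?a ?b] |- _ =>
          lazymatch G' with H => fail | R_AbelianMonoid => fail
          | _ => change (@plus G' a b) with (@plus H a b) in h end
      end
  end.

Ltac norm_lra := canonical_paths; lra.

Section Norms.
Context {X : CompleteNormedModule R_AbsRing}.
Implicit Types u v w : X.

(** The reverse of [norm_scal] is [norm_scal] itself, for [/ a] and [scal a u]. *)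
Lemma norm_scal_eq (a : R) (u : X) : norm (scal a u) = Rabs a * norm u.
Proof.
  apply Rle_antisym; [exact (norm_scal a u)|].
  destruct (Req_dec a 0) as [->|Ha].
  - rewrite Rabs_R0, Rmult_0_l. apply norm_ge_0.
  - apply Rmult_le_reg_l with (Rabs (/ a)).
    { apply Rabs_pos_lt. now apply Rinv_neq_0_compat. }
    rewrite <- Rmult_assoc, <- Rabs_mult, Rinv_l, Rabs_R1, Rmult_1_l by assumption.
    replace u with (scal (/ a) (scal a u)) at 1.
    + exact (norm_scal (/ a) (scal a u)).
    + vec. now field.
Qed.

Lemma norm_plus_le u v : norm (plus u v) <= norm u + norm v.
Proof. exact (norm_triangle u v). Qed.

Lemma norm_minus_le u v : norm (minus u v) <= norm u + norm v.
Proof. rewrite <- (norm_opp v). exact (norm_triangle u (opp v)). Qed.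

Lemma norm_zero_eq : norm (zero : X) = 0.
Proof. exact norm_zero. Qed.

Lemma norm_minus_diag u : norm (minus u u) = 0.
Proof. rewrite minus_eq_zero. exact norm_zero. Qed.

Lemma norm_minus_sym u v : norm (minus u v) = norm (minus v u).
Proof. rewrite <- norm_opp. f_equal. vec. Qed.

Lemma norm_minus_triangle u v w :
  norm (minus u w) <= norm (minus u v) + norm (minus v w).
Proof.
  replace (minus u w) with (plus (minus u v) (minus v w)) by vec.
  apply norm_plus_le.
Qed.

Lemma norm_le_minus u v : norm u <= norm (minus u v) + norm v.
Proof.
  replace u with (plus (minus u v) v) at 1 by vec. apply norm_plus_le.
Qed.

Lemma minus_eq_zero_norm u v : norm (minus u v) = 0 -> u = v.
Proof.
  intros H. apply norm_eq_zero in H.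
  replace u with (plus (minus u v) v) by vec. rewrite H. apply plus_zero_l.
Qed.

Lemma filterlim_norm_iff {T : Type} (F : (T -> Prop) -> Prop) {FF : Filter F}
    (f : T -> X) (l : X) :
  filterlim f F (locally l) <->
  (forall eps : R, 0 < eps -> F (fun x => norm (minus (f x) l) < eps)).
Proof.
  rewrite (filterlim_locally_ball_norm (F := F) f l). split.
  - intros H eps Heps. exact (H (mkposreal eps Heps)).
  - intros H eps. exact (H eps (cond_pos eps)).
Qed.

Lemma filterlim_norm_le {T : Type} (F : (T -> Prop) -> Prop) {FF : Filter F}
    (f : T -> X) (l : X) (g : T -> R) :
  F (fun x => norm (minus (f x) l) <= g x) -> filterlim g F (locally 0) ->
  filterlim f F (locally l).
Proof.
  intros Hle Hg. apply filterlim_norm_iff; [assumption|]. intros eps Heps.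
  pose proof (proj1 (filterlim_locally g 0) Hg (mkposreal eps Heps)) as Hg'.
  generalize (filter_and _ _ Hle Hg'). apply filter_imp.
  intros x [H1 H2]. apply Rle_lt_trans with (1 := H1).
  apply Rle_lt_trans with (2 := H2). simpl.
  change (g x <= Rabs (g x - 0)). rewrite Rminus_0_r. apply Rle_abs.
Qed.

Lemma filterlim_plus_fun {T : Type} (F : (T -> Prop) -> Prop) {FF : Filter F}
    (f g : T -> X) (l m : X) :
  filterlim f F (locally l) -> filterlim g F (locally m) ->
  filterlim (fun x => plus (f x) (g x)) F (locally (plus l m)).
Proof.
  intros Hf Hg. exact (filterlim_comp_2 (F := F) _ _ plus Hf Hg (filterlim_plus l m)).
Qed.

Lemma filterlim_scal_fun {T : Type} (F : (T -> Prop) -> Prop) {FF : Filter F}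
    (a : T -> R) (f : T -> X) (b : R) (l : X) :
  filterlim a F (locally b) -> filterlim f F (locally l) ->
  filterlim (fun x => scal (a x) (f x)) F (locally (scal b l)).
Proof.
  intros Ha Hf. exact (filterlim_comp_2 (F := F) _ _ scal Ha Hf (filterlim_scal (K := R_AbsRing) b l)).
Qed.

Lemma filterlim_opp_fun {T : Type} (F : (T -> Prop) -> Prop) {FF : Filter F}
    (f : T -> X) (l : X) :
  filterlim f F (locally l) -> filterlim (fun x => opp (f x)) F (locally (opp l)).
Proof. intros Hf. eapply filterlim_comp; [exact Hf|exact (filterlim_opp l)]. Qed.

Lemma filterlim_minus_fun {T : Type} (F : (T -> Prop) -> Prop) {FF : Filter F}
    (f g : T -> X) (l m : X) :
  filterlim f F (locally l) -> filterlim g F (locally m) ->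
  filterlim (fun x => minus (f x) (g x)) F (locally (minus l m)).
Proof. intros Hf Hg. apply filterlim_plus_fun; [exact _|exact Hf|apply filterlim_opp_fun; [exact _|exact Hg]]. Qed.

Lemma filterlim_sum_n {T : Type} (F : (T -> Prop) -> Prop) {FF : Filter F}
    (f : nat -> T -> X) (l : nat -> X) (n : nat) :
  (forall k, (k <= n)%nat -> filterlim (f k) F (locally (l k))) ->
  filterlim (fun x => sum_n (fun k => f k x) n) F (locally (sum_n l n)).
Proof.
  induction n as [|n IH]; intros H.
  - rewrite sum_O. apply filterlim_ext with (f 0%nat).
    + intros x. now rewrite sum_O.
    + now apply H.
  - rewrite sum_Sn.
    apply filterlim_ext with (fun x => plus (sum_n (fun k => f k x) n) (f (S n) x)).
    + intros x. now rewrite sum_Sn.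
    + apply filterlim_plus_fun; [exact _|apply IH; intros; apply H; lia|now apply H].
Qed.

Lemma norm_filterlim_le {T : Type} (F : (T -> Prop) -> Prop) {FF : ProperFilter F}
    (f : T -> X) (l : X) (M : R) :
  filterlim f F (locally l) -> F (fun x => norm (f x) <= M) -> norm l <= M.
Proof.
  intros Hf HM. apply Rnot_lt_le. intros Hlt.
  assert (Hd : 0 < norm l - M) by lra.
  pose proof (proj1 (filterlim_norm_iff F f l) Hf _ Hd) as H.
  destruct (filter_ex _ (filter_and _ _ HM H)) as [x [H1 H2]].
  pose proof (norm_le_minus l (f x)). rewrite norm_minus_sym in H0. lra.
Qed.

Lemma linear_minus (l : X -> X) (u v : X) :
  is_linear l -> l (minus u v) = minus (l u) (l v).
Proof.
  intros Hl. unfold minus. rewrite (linear_plus l Hl). f_equal.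
  exact (linear_opp l v Hl).
Qed.

(** Serves both the nested balls of Baire's argument, with radii [d n], and geometric series with
    remainders [d n]. As the bound at [n] holds for all later indices, arbitrarily small values of
    [d] suffice. *)
Lemma nested_cauchy_limit (a : nat -> X) (d : nat -> R) :
  (forall n m, (n <= m)%nat -> norm (minus (a m) (a n)) <= d n) ->
  (forall eps, 0 < eps -> exists n, d n < eps) ->
  exists l : X, filterlim a eventually (locally l) /\
    forall n, norm (minus l (a n)) <= d n.
Proof.
  intros Ha Hd.
  assert (Hl : exists l : X, filterlim a eventually (locally l)).
  { apply (filterlim_locally_cauchy (F := eventually) a). intros eps.
    destruct (Hd (eps / 2)) as [n Hn]; [pose proof (cond_pos eps); lra|].
    exists (fun m => (n <= m)%nat). split; [now exists n|].
    intros p q Hp Hq. apply (norm_compat1 (a p : X)).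
    apply Rle_lt_trans with (1 := norm_minus_triangle (a q) (a n) (a p)).
    rewrite (norm_minus_sym (a n)).
    pose proof (Ha n p Hp). pose proof (Ha n q Hq). lra. }
  destruct Hl as [l Hl]. exists l. split; [exact Hl|]. intros n.
  apply (norm_filterlim_le eventually (fun m => minus (a m) (a n))).
  - apply filterlim_minus_fun; [exact _|exact Hl|apply filterlim_const].
  - exists n. intros m Hm. now apply Ha.
Qed.

End Norms.

(** * The cone decomposition is bounded *)

Section Decomposition.
Context (X : CompleteNormedModule R_AbsRing) (pos : X -> Prop).
Hypothesis hX : abstract_state_space X pos.

(** This is [r] times the convex hull of the positive part of the unit ball and its opposite; a
    bounded decomposition means that some [K r] contains the unit ball. *)
Let K (r : R) (u : X) : Prop :=
  exists v w : X, pos v /\ pos w /\ u = minus v w /\ norm v + norm w <= r.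

Let K_minus (r s : R) (u v : X) : K r u -> K s v -> K (r + s) (minus u v).
Proof.
  intros (v1 & w1 & Hv1 & Hw1 & -> & H1) (v2 & w2 & Hv2 & Hw2 & -> & H2).
  exists (plus v1 w2), (plus w1 v2).
  repeat split; try (now apply (pos_plus X pos hX)).
  - vec.
  - rewrite !(norm_additive X pos hX) by assumption. lra.
Qed.

Let K_scal (r a : R) (u : X) : 0 <= a -> K r u -> K (a * r) (scal a u).
Proof.
  intros Ha (v & w & Hv & Hw & -> & H). exists (scal a v), (scal a w).
  repeat split; try (now apply (pos_scal X pos hX)).
  - vec.
  - rewrite !norm_scal_eq, Rabs_pos_eq by assumption. nra.
Qed.

(* Baire's theorem for the sets [K n], which cover [X] since the cone is
   generating. *)
Let K_somewhere_dense :
  exists (n : nat) (c : X) (d : R), 0 < d /\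
    forall x, norm (minus x c) < d ->
    forall eps, 0 < eps -> exists y, K (INR n) y /\ norm (minus x y) < eps.
Proof.
  apply NNPP. intros Hneg.
  (* If [K n] is dense in no ball, every ball contains a closed ball of at most half its radius that
     misses [K n]. *)
  assert (step : forall (n : nat) (p : X * posreal), exists q : X * posreal,
    (forall y, norm (minus y (fst q)) <= snd q ->
       norm (minus y (fst p)) <= snd p /\ ~ K (INR n) y) /\
    snd q <= snd p / 2).
  { intros n [c d]. pose proof (cond_pos d) as Hd. apply NNPP. intros Hn. apply Hneg.
    exists n, c, (d / 2). split; [lra|]. intros x Hx eps Heps.
    apply NNPP. intros Hy. apply Hn.
    (* [eps / 2] keeps the closed ball around [x] inside the hole of radius [eps] in [K n]; [d / 2]
       keeps it inside the ball of radius [d] around [c] and halves the radius. *)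
    assert (He : 0 < Rmin (eps / 2) (d / 2)) by (apply Rmin_pos; lra).
    exists (x, mkposreal _ He). simpl. split; [|apply Rmin_r].
    intros y Hy'. split.
    - apply Rle_trans with (1 := norm_minus_triangle y x c).
      pose proof (Rmin_r (eps / 2) (d / 2)). lra.
    - intros HK. apply Hy. exists y. split; [exact HK|].
      rewrite norm_minus_sym. pose proof (Rmin_l (eps / 2) (d / 2)). lra. }
  destruct (choice (fun np q => _) (fun np => step (fst np) (snd np))) as [f Hf].
  set (b := fix b n := match n with
                       | O => (zero, mkposreal 1 Rlt_0_1) : X * posreal
                       | S n => f (n, b n) end).
  assert (Hb : forall n m, (n <= m)%nat -> forall y,
    norm (minus y (fst (b m))) <= snd (b m) -> norm (minus y (fst (b n))) <= snd (b n)).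
  { intros n m Hnm. induction Hnm as [|m Hnm IH]; [auto|]. intros y Hy.
    apply IH. now apply (Hf (m, b m)). }
  assert (Hs : forall n, snd (b n) <= (1 / 2) ^ n).
  { induction n as [|n IH]; [simpl; lra|].
    apply Rle_trans with (1 := proj2 (Hf (n, b n))). change (snd (b n) / 2 <= 1 / 2 * (1 / 2) ^ n). lra. }
  destruct (nested_cauchy_limit (fun n => fst (b n)) (fun n => snd (b n)))
    as (l & _ & Hl).
  - intros n m Hnm. apply (Hb n m Hnm). rewrite norm_minus_diag.
    apply Rlt_le, cond_pos.
  - intros eps Heps. destruct (pow_lt_1_zero (1 / 2)) with (y := eps) as [N HN];
      [rewrite Rabs_pos_eq; lra|exact Heps|].
    exists N. apply Rle_lt_trans with (1 := Hs N).
    apply Rle_lt_trans with (2 := HN N (le_n N)). apply Rle_abs.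
  (* The common point [l] of the balls is outside every [K n], whereas any decomposition of [l] puts
     it in [K n] for large [n]. *)
  - destruct (pos_generating X pos hX l) as (v & w & Hv & Hw & Heq).
    destruct (INR_archimed 1 (norm v + norm w)) as [n Hn]; [lra|].
    apply (proj2 (proj1 (Hf (n, b n)) l (Hl (S n)))).
    exists v, w. repeat split; try assumption. simpl fst. lra.
Qed.

(** The ball in which [K n] is dense is moved to the origin by subtracting two approximants, one of
    them of its centre [c], and is then rescaled to the size of [x]. *)
Let K_dense :
  exists C : R, 0 < C /\ forall x : X, exists y : X,
    K (C * norm x) y /\ norm (minus x y) <= norm x / 2.
Proof.
  destruct K_somewhere_dense as (n & c & d & Hd & H).
  pose proof (pos_INR n) as Hn.
  (* The summand [1] ensures positivity, since [n] may be [0]. *)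
  exists (4 * INR n / d + 1). split.
  { apply Rplus_le_lt_0_compat; [|lra].
    apply Rmult_le_pos; [lra|]. apply Rlt_le. now apply Rinv_0_lt_compat. }
  intros x. destruct (Req_dec (norm x) 0) as [H0|H0].
  - exists zero. split.
    + exists zero, zero.
      repeat split; try apply (pos_zero X pos hX); [vec|].
      rewrite !norm_zero_eq, H0. lra.
    + replace (minus x (zero : X)) with x by vec. rewrite H0. lra.
  - assert (Hx : 0 < norm x) by (destruct (norm_ge_0 x); [assumption|congruence]).
    (* With this [r], [scal (/ r) x] has norm [d / 2] and fits in the ball. Rescaling turns the two
       errors [d / 8] into [r * (d / 4) = norm x / 2], and the size [2 * INR n] into
       [4 * INR n / d * norm x]. *)
    set (r := 2 * norm x / d).
    assert (Hr : 0 < r) by (apply Rmult_lt_0_compat; [lra|now apply Rinv_0_lt_compat]).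
    assert (Heps : 0 < d / 8) by lra.
    destruct (H (plus c (scal (/ r) x))) with (eps := d / 8) as (y1 & Ky1 & Hy1);
      [|exact Heps|].
    { replace (minus (plus c (scal (/ r) x)) c) with (scal (/ r) x) by vec.
      rewrite norm_scal_eq, Rabs_pos_eq by (apply Rlt_le; now apply Rinv_0_lt_compat).
      unfold r. replace (/ (2 * norm x / d) * norm x) with (d / 2) by (field; lra). lra. }
    destruct (H c) with (eps := d / 8) as (y2 & Ky2 & Hy2); [|exact Heps|].
    { rewrite norm_minus_diag. exact Hd. }
    exists (scal r (minus y1 y2)). split.
    + destruct (K_scal _ r _ (Rlt_le _ _ Hr) (K_minus _ _ _ _ Ky1 Ky2))
        as (v & w & Hv & Hw & Heq & Hle).
      exists v, w. repeat split; try assumption.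
      apply Rle_trans with (1 := Hle). unfold r.
      replace (2 * norm x / d * (INR n + INR n)) with (4 * INR n / d * norm x)
        by (field; lra). lra.
    + replace (minus x (scal r (minus y1 y2))) with
        (scal r (minus (minus (plus c (scal (/ r) x)) y1) (minus c y2)))
        by (vec; field; lra).
      rewrite norm_scal_eq, Rabs_pos_eq by lra.
      apply Rle_trans with (r * (d / 4)).
      * apply Rmult_le_compat_l; [lra|]. eapply Rle_trans; [apply norm_minus_le|]. lra.
      * unfold r. apply Req_le. field. lra.
Qed.

(** Successive approximation, as in the open mapping theorem: each step decomposes the remainder up
    to half of its norm, so the parts form series of total size at most
    [C * norm x * (1 + 1/2 + 1/4 + ...)]. Completeness provides the sums and closedness of the cone
    keeps them positive. *)
Lemma bounded_decomposition :
  exists M : R, 0 < M /\ forall u : X, exists v w : X,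
    pos v /\ pos w /\ u = minus v w /\ norm v + norm w <= M * norm u.
Proof.
  destruct K_dense as (C & HC & Hstep). exists (2 * C). split; [lra|]. intros x.
  assert (step : forall p : X * X, exists q : X * X, pos (fst q) /\ pos (snd q) /\
    let r := minus x (minus (fst p) (snd p)) in
    norm (fst q) + norm (snd q) <= C * norm r /\
    norm (minus r (minus (fst q) (snd q))) <= norm r / 2).
  { intros [s t]. destruct (Hstep (minus x (minus s t)))
      as (y & (v & w & Hv & Hw & -> & H1) & H2).
    exists (v, w). simpl. auto. }
  destruct (choice _ step) as [f Hf].
  set (b := fix b n := match n with
     | O => (zero, zero) : X * X
     | S n => (plus (fst (b n)) (fst (f (b n))), plus (snd (b n)) (snd (f (b n)))) end).
  set (h := fun n => (1 / 2) ^ n).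
  assert (Hh : forall n, 0 < h n) by (intros n; apply pow_lt; lra).
  assert (Hpos : forall n, pos (fst (b n)) /\ pos (snd (b n))).
  { induction n as [|n [IH1 IH2]]; simpl.
    - split; apply (pos_zero X pos hX).
    - split; apply (pos_plus X pos hX); try assumption; apply (Hf (b n)). }
  assert (Hres : forall n, norm (minus x (minus (fst (b n)) (snd (b n)))) <= h n * norm x).
  { induction n as [|n IH].
    - unfold h. simpl. replace (minus x (minus (zero : X) (zero : X))) with x by vec. lra.
    - destruct (Hf (b n)) as (_ & _ & _ & H2).
      cbn [b fst snd]. fold b.
      replace (minus x _) with
        (minus (minus x (minus (fst (b n)) (snd (b n))))
               (minus (fst (f (b n))) (snd (f (b n))))) by vec.
      apply Rle_trans with (1 := H2). unfold h in *. simpl. lra. }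
  assert (Hinc : forall n, norm (fst (f (b n))) + norm (snd (f (b n)))
                           <= C * norm x * h n).
  { intros n. destruct (Hf (b n)) as (_ & _ & H1 & _).
    apply Rle_trans with (1 := H1). specialize (Hres n). nra. }
  (* Telescoping form of the geometric bound, from [h m = 2 * (h m - h (S m))]. *)
  assert (Hcau : forall n m, (n <= m)%nat ->
    norm (minus (fst (b m)) (fst (b n))) <= 2 * C * norm x * (h n - h m) /\
    norm (minus (snd (b m)) (snd (b n))) <= 2 * C * norm x * (h n - h m)).
  { intros n m Hnm. induction Hnm as [|m Hnm [IH1 IH2]].
    - rewrite !norm_minus_diag. lra.
    - specialize (Hinc m). pose proof (norm_ge_0 (fst (f (b m)))).
      pose proof (norm_ge_0 (snd (f (b m)))).
      cbn [b fst snd]. fold b.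
      replace (h (S m)) with (h m / 2) by (unfold h; simpl; lra).
      split.
      + replace (minus (plus (fst (b m)) (fst (f (b m)))) (fst (b n))) with
          (plus (minus (fst (b m)) (fst (b n))) (fst (f (b m)))) by vec.
        eapply Rle_trans; [apply norm_plus_le|]. lra.
      + replace (minus (plus (snd (b m)) (snd (f (b m)))) (snd (b n))) with
          (plus (minus (snd (b m)) (snd (b n))) (snd (f (b m)))) by vec.
        eapply Rle_trans; [apply norm_plus_le|]. lra. }
  assert (Hsum : forall n, norm (fst (b n)) + norm (snd (b n)) <= 2 * C * norm x).
  { assert (Hs : forall n, norm (fst (b n)) + norm (snd (b n))
                           <= 2 * C * norm x * (1 - h n)).
    { induction n as [|n IH].
      - simpl. unfold h. rewrite !norm_zero_eq. simpl. lra.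
      - destruct (Hpos n) as [P1 P2]. destruct (Hf (b n)) as (Q1 & Q2 & _ & _).
        cbn [b fst snd]. fold b. rewrite !(norm_additive X pos hX) by assumption.
        specialize (Hinc n).
        replace (h (S n)) with (h n / 2) by (unfold h; simpl; lra). lra. }
    intros n. apply Rle_trans with (1 := Hs n). specialize (Hh n).
    pose proof (norm_ge_0 x). assert (0 <= C * norm x) by nra. nra. }
  assert (Hsmall : forall eps, 0 < eps -> exists n, 2 * C * norm x * h n < eps).
  { intros eps Heps. pose proof (norm_ge_0 x).
    assert (0 <= C * norm x) by nra.
    destruct (pow_lt_1_zero (1 / 2)) with (y := eps / (2 * C * norm x + 1)) as [N HN].
    - rewrite Rabs_pos_eq; lra.
    - apply Rdiv_lt_0_compat; lra.
    - exists N. specialize (HN N (le_n N)). fold (h N) in HN. specialize (Hh N).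
      rewrite Rabs_pos_eq in HN by lra.
      apply (Rmult_lt_compat_r (2 * C * norm x + 1)) in HN; [|lra].
      replace (eps / (2 * C * norm x + 1) * (2 * C * norm x + 1)) with eps in HN
        by (field; lra). nra. }
  assert (Hdrop : forall n m, 2 * C * norm x * (h n - h m) <= 2 * C * norm x * h n).
  { intros n m. specialize (Hh m). pose proof (norm_ge_0 x).
    assert (0 <= C * norm x) by nra. nra. }
  destruct (nested_cauchy_limit (fun n => fst (b n)) (fun n => 2 * C * norm x * h n))
    as (v & Hv & Hv'); [|exact Hsmall|].
  { intros n m Hnm. eapply Rle_trans; [apply (Hcau n m Hnm)|apply Hdrop]. }
  destruct (nested_cauchy_limit (fun n => snd (b n)) (fun n => 2 * C * norm x * h n))
    as (w & Hw & Hw'); [|exact Hsmall|].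
  { intros n m Hnm. eapply Rle_trans; [apply (Hcau n m Hnm)|apply Hdrop]. }
  assert (Pv : pos v).
  { apply (closed_filterlim (F := eventually) (fun n => fst (b n)));
      [exact Hv|intros n; apply Hpos|apply (pos_closed X pos hX)]. }
  assert (Pw : pos w).
  { apply (closed_filterlim (F := eventually) (fun n => snd (b n)));
      [exact Hw|intros n; apply Hpos|apply (pos_closed X pos hX)]. }
  exists v, w. repeat split; try assumption.
  - apply (filterlim_locally_unique (F := eventually)
      (fun n => minus (fst (b n)) (snd (b n)))).
    + apply filterlim_norm_iff; [exact _|]. intros eps Heps.
      destruct (Hsmall (C * eps)) as [N HN]; [nra|]. exists N. intros n Hn.
      rewrite norm_minus_sym. apply Rle_lt_trans with (1 := Hres n).
      assert (h n <= h N).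
      { unfold h. clear - Hn. induction Hn as [|m Hm IH]; [lra|].
        simpl. pose proof (pow_lt (1 / 2) m ltac:(lra)). lra. }
      assert (2 * norm x * h N < eps) by (apply Rmult_lt_reg_l with C; lra).
      specialize (Hh N). pose proof (norm_ge_0 x). nra.
    + apply filterlim_minus_fun; [exact _|exact Hv|exact Hw].
  - rewrite <- (norm_additive X pos hX) by assumption.
    apply (norm_filterlim_le eventually
      (fun n => plus (fst (b n)) (snd (b n)))).
    + apply filterlim_plus_fun; [exact _|exact Hv|exact Hw].
    + exists 0%nat. intros n _. destruct (Hpos n).
      rewrite (norm_additive X pos hX) by assumption. apply Hsum.
Qed.

End Decomposition.

(** * Integration *)

Lemma Riemann_sum_linear {Y Z : NormedModule R_AbsRing} (l : Y -> Z) (f : R -> Y)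
    (p : SF_seq) :
  is_linear l -> l (Riemann_sum f p) = Riemann_sum (fun s => l (f s)) p.
Proof.
  intros Hl. induction p as [x|h p IH] using SF_cons_ind.
  - exact (linear_zero l Hl).
  - rewrite !Riemann_sum_cons. rewrite <- IH.
    etransitivity; [exact (linear_plus l Hl _ _)|]. f_equal.
    exact (linear_scal l Hl _ _).
Qed.

(** Applied to [U h], [V k t] and [Psi]; [B] is out of reach, since [is_linear] includes
    boundedness. *)
Lemma is_RInt_linear {Y Z : NormedModule R_AbsRing} (l : Y -> Z) (f : R -> Y)
    (a b : R) (I : Y) :
  is_linear l -> is_RInt f a b I -> is_RInt (fun s => l (f s)) a b (l I).
Proof.
  intros Hl HI. unfold is_RInt in *.
  apply filterlim_ext with (fun p => l (scal (sign (b - a)) (Riemann_sum f p))).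
  - intros p. rewrite <- (Riemann_sum_linear l f p Hl). exact (linear_scal l Hl _ _).
  - eapply filterlim_comp; [exact HI|exact (linear_cont l I Hl)].
Qed.

Lemma Riemann_sum_in_cone {X : CompleteNormedModule R_AbsRing} (pos : X -> Prop)
    (f : R -> X) (p : SF_seq) :
  abstract_state_space X pos -> pointed_subdiv p ->
  (forall s, SF_h p <= s <= seq.last (SF_h p) (SF_lx p) -> pos (f s)) ->
  pos (Riemann_sum f p).
Proof.
  intros hX. induction p as [x|h p IH] using SF_cons_ind; intros Hp Hf.
  - exact (pos_zero X pos hX).
  - rewrite Riemann_sum_cons.
    assert (Hh : fst h <= snd h <= SF_h p).
    { apply (Hp 0%nat). rewrite SF_size_cons. lia. }
    assert (Hq : pointed_subdiv p) by exact (ptd_cons h p Hp).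
    assert (Hlast : SF_h p <= seq.last (SF_h p) (SF_lx p)).
    { apply (sorted_last (SF_lx p) 0); [apply ptd_sort, Hq|simpl; lia]. }
    apply (pos_plus X pos hX).
    + apply (pos_scal X pos hX); [lra|]. apply Hf. simpl in *. lra.
    + apply IH; [exact Hq|]. intros s Hs. apply Hf. simpl in *. lra.
Qed.

Section HalfLine.
Context {X : CompleteNormedModule R_AbsRing}.

Lemma is_RInt_plus_fun (f g : R -> X) (a b : R) (I J : X) :
  is_RInt f a b I -> is_RInt g a b J ->
  is_RInt (fun s => plus (f s) (g s)) a b (plus I J).
Proof. intros HI HJ. exact (is_RInt_plus f g a b I J HI HJ). Qed.

Lemma is_RInt_scal_fun (f : R -> X) (k a b : R) (I : X) :
  is_RInt f a b I -> is_RInt (fun s => scal k (f s)) a b (scal k I).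
Proof. intros HI. exact (is_RInt_scal f a b k I HI). Qed.

(** Riemann sums of positive vectors have nonnegative weights, hence stay in the cone, which is
    closed. *)
Lemma is_RInt_in_cone (pos : X -> Prop) (f : R -> X) (a b : R) (I : X) :
  abstract_state_space X pos -> a <= b ->
  (forall s, a <= s <= b -> pos (f s)) -> is_RInt f a b I -> pos I.
Proof.
  intros hX Hab Hf HI.
  apply (closed_filterlim_loc (F := Riemann_fine a b)
    (fun p => scal (sign (b - a)) (Riemann_sum f p))).
  - exact HI.
  - exists (mkposreal 1 Rlt_0_1). intros p _ (Hp & H1 & H2).
    rewrite Rmin_left in H1 by lra. rewrite Rmax_right in H2 by lra.
    apply (pos_scal X pos hX); [now apply sign_ge_0; lra|].
    apply (Riemann_sum_in_cone pos f p hX Hp). intros s Hs. apply Hf.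
    rewrite H2, H1 in Hs. exact Hs.
  - exact (pos_closed X pos hX).
Qed.

Lemma norm_RInt_minus_const (f : R -> X) (a b eps : R) (I l : X) :
  a <= b -> is_RInt f a b I ->
  (forall s, a <= s <= b -> norm (minus (f s) l) <= eps) ->
  norm (minus I (scal (b - a) l)) <= (b - a) * eps.
Proof.
  intros Hab HI H. apply (norm_RInt_le_const (fun s => minus (f s) l) a b); [exact Hab|exact H|].
  exact (is_RInt_minus _ _ _ _ _ _ HI (is_RInt_const a b l)).
Qed.

(** Operator families carry no information at negative times, so continuity at [0] has to be
    relative to the half-line. *)
Definition half_continuous (f : R -> X) : Prop :=
  forall t, 0 <= t -> filterlim f (within (Rle 0) (locally t)) (locally (f t)).

Lemma half_continuous_scal (a : R -> R) (f : R -> X) :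
  (forall t, continuous a t) -> half_continuous f ->
  half_continuous (fun s => scal (a s) (f s)).
Proof.
  intros Ha Hf t Ht. apply filterlim_scal_fun; [exact _| |now apply Hf].
  apply (filterlim_filter_le_1 (F := locally t)); [apply filter_le_within|apply Ha].
Qed.

Lemma half_continuous_minus (f g : R -> X) :
  half_continuous f -> half_continuous g ->
  half_continuous (fun s => minus (f s) (g s)).
Proof. intros Hf Hg t Ht. apply filterlim_minus_fun; [exact _|auto|auto]. Qed.

Lemma half_continuous_plus (f g : R -> X) :
  half_continuous f -> half_continuous g ->
  half_continuous (fun s => plus (f s) (g s)).
Proof. intros Hf Hg t Ht. apply filterlim_plus_fun; [exact _|auto|auto]. Qed.

Lemma half_continuous_ext (f g : R -> X) :
  (forall t, 0 <= t -> f t = g t) -> half_continuous f -> half_continuous g.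
Proof.
  intros Hfg Hf t Ht. rewrite <- Hfg by exact Ht.
  apply filterlim_ext_loc with f; [|now apply Hf].
  exists (mkposreal 1 Rlt_0_1). intros s _ Hs. now apply Hfg.
Qed.

Lemma half_continuous_norm (f : R -> X) :
  half_continuous f <-> forall t, 0 <= t -> forall eps, 0 < eps ->
    exists d, 0 < d /\ forall s, 0 <= s -> Rabs (s - t) < d ->
      norm (minus (f s) (f t)) < eps.
Proof.
  split; intros Hf t Ht.
  - intros eps Heps.
    destruct (proj1 (filterlim_norm_iff _ _ _) (Hf t Ht) eps Heps) as [d Hd].
    exists d. split; [apply cond_pos|]. intros s Hs Hst. now apply Hd.
  - apply filterlim_norm_iff; [exact _|]. intros eps Heps.
    destruct (Hf t Ht eps Heps) as (d & Hd & H). exists (mkposreal d Hd).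
    intros s Hst Hs. now apply H.
Qed.

Lemma half_continuous_at (f : R -> X) (t : R) :
  half_continuous f -> 0 < t -> continuous f t.
Proof.
  intros Hf Ht P HP. specialize (Hf t (Rlt_le _ _ Ht) P HP).
  destruct Hf as [d Hd].
  assert (He : 0 < Rmin d t) by (apply Rmin_pos; [apply cond_pos|exact Ht]).
  exists (mkposreal _ He). intros s Hs. change (Rabs (s - t) < Rmin d t) in Hs.
  pose proof (Rmin_l d t). pose proof (Rmin_r d t).
  apply Hd.
  - change (Rabs (s - t) < d). lra.
  - apply Rabs_def2 in Hs. lra.
Qed.

Lemma half_continuous_ex_RInt (f : R -> X) (a b : R) :
  half_continuous f -> 0 <= a -> 0 <= b -> ex_RInt f a b.
Proof.
  intros Hf Ha Hb.
  (* The extension by the constant [f 0] to negative times is continuous on the whole line. *)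
  apply ex_RInt_ext with (fun s => f (Rmax 0 s)).
  - intros s Hs. f_equal. apply Rmax_right.
    apply Rle_trans with (Rmin a b); [now apply Rmin_glb|lra].
  - apply ex_RInt_continuous. intros s _ P HP.
    destruct (Hf (Rmax 0 s) (Rmax_l 0 s) P HP) as [d Hd]. exists d. intros r Hr.
    apply Hd; [|apply Rmax_l]. change (Rabs (Rmax 0 r - Rmax 0 s) < d).
    change (Rabs (r - s) < d) in Hr. apply Rle_lt_trans with (2 := Hr).
    unfold Rmax. destruct (Rle_dec 0 r), (Rle_dec 0 s); unfold Rabs;
      repeat destruct Rcase_abs; lra.
Qed.

Lemma half_continuous_is_RInt (f : R -> X) (a b : R) :
  half_continuous f -> 0 <= a -> 0 <= b -> is_RInt f a b (RInt f a b).
Proof.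
  intros Hf Ha Hb. apply (RInt_correct f a b). now apply half_continuous_ex_RInt.
Qed.

Lemma half_continuous_average (f : R -> X) (t : R) :
  half_continuous f -> 0 <= t ->
  filterlim (fun h => scal (/ h) (RInt f t (t + h))) (at_right 0) (locally (f t)).
Proof.
  intros Hf Ht. apply filterlim_norm_iff; [exact _|]. intros eps Heps.
  destruct (proj1 (half_continuous_norm f) Hf t Ht (eps / 2)) as (d & Hd & H); [lra|].
  exists (mkposreal d Hd). intros h Hh Hh0.
  change (Rabs (h - 0) < d) in Hh. rewrite Rminus_0_r, Rabs_pos_eq in Hh by lra.
  assert (Hi : is_RInt f t (t + h) (RInt f t (t + h)))
    by (apply half_continuous_is_RInt; [exact Hf|lra|lra]).
  apply (norm_RInt_minus_const f t (t + h) (eps / 2) _ (f t)) in Hi; [|lra|].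
  - replace (minus (scal (/ h) (RInt f t (t + h)) : X) (f t)) with
      (scal (/ h) (minus (RInt f t (t + h)) (scal (t + h - t) (f t))))
      by (vec; field; lra).
    rewrite norm_scal_eq, Rabs_pos_eq by (apply Rlt_le; now apply Rinv_0_lt_compat).
    apply Rle_lt_trans with (/ h * ((t + h - t) * (eps / 2))).
    + apply Rmult_le_compat_l; [apply Rlt_le; now apply Rinv_0_lt_compat|exact Hi].
    + replace (/ h * ((t + h - t) * (eps / 2))) with (eps / 2) by (field; lra). lra.
  - intros s Hs. apply Rlt_le, H; [lra|]. rewrite Rabs_pos_eq; lra.
Qed.

(** * Truncated Laplace transforms *)

(** [lambda = 0] gives plain integrals, and [T] tending to infinity gives those of resolvent type,
    so both kinds share one computation. *)
Definition laplace (lambda : R) (f : R -> X) (T : R) : X :=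
  RInt (fun s => scal (exp (- lambda * s)) (f s)) 0 T.

Lemma exp_continuous (a t : R) : continuous (fun s : R => exp (a * s)) t.
Proof. apply (ex_derive_continuous (fun s : R => exp (a * s))). auto_derive. trivial. Qed.

Lemma half_continuous_exp (lambda : R) (f : R -> X) :
  half_continuous f -> half_continuous (fun s => scal (exp (- lambda * s)) (f s)).
Proof. intros Hf. apply half_continuous_scal; [|exact Hf]. apply exp_continuous. Qed.

Lemma is_RInt_laplace (lambda : R) (f : R -> X) (T : R) :
  half_continuous f -> 0 <= T ->
  is_RInt (fun s => scal (exp (- lambda * s)) (f s)) 0 T (laplace lambda f T).
Proof.
  intros Hf HT. apply half_continuous_is_RInt; [now apply half_continuous_exp|lra|lra].
Qed.

Lemma laplace_minus (lambda : R) (f : R -> X) (S T : R) :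
  half_continuous f -> 0 <= S -> 0 <= T ->
  is_RInt (fun s => scal (exp (- lambda * s)) (f s)) S T
    (minus (laplace lambda f T) (laplace lambda f S)).
Proof.
  intros Hf HS HT. pose proof (half_continuous_exp lambda f Hf) as Hg.
  replace (minus _ _) with (RInt (fun s => scal (exp (- lambda * s)) (f s)) S T).
  - now apply half_continuous_is_RInt.
  - unfold laplace.
    rewrite <- (RInt_Chasles (fun s => scal (exp (- lambda * s)) (f s)) 0 S T).
    + vec.
    + apply half_continuous_ex_RInt; [exact Hg|lra|lra].
    + now apply half_continuous_ex_RInt.
Qed.

(** Substituting [s + h] for the variable: a shift of the orbit costs the factor [exp (lambda * h)]
    and moves the window of integration to [[h, T + h]]. *)
Lemma is_RInt_laplace_shift (lambda : R) (f : R -> X) (h T : R) :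
  half_continuous f -> 0 <= h -> 0 <= T ->
  is_RInt (fun s => scal (exp (- lambda * s)) (f (s + h))) 0 T
    (scal (exp (lambda * h)) (minus (laplace lambda f (T + h)) (laplace lambda f h))).
Proof.
  intros Hf Hh HT.
  pose proof (laplace_minus lambda f h (T + h) Hf Hh ltac:(lra)) as H.
  replace h with (1 * 0 + h) in H at 1 by ring.
  replace (T + h) with (1 * T + h) in H at 1 by ring.
  apply is_RInt_comp_lin in H.
  apply (is_RInt_scal _ _ _ (exp (lambda * h))) in H.
  apply is_RInt_ext with (2 := H). intros s _.
  replace (1 * s + h) with (s + h) by ring.
  replace (exp (- lambda * (s + h))) with (exp (- lambda * s) * / exp (lambda * h)).
  - vec. field. apply Rgt_not_eq, exp_pos.
  - rewrite <- exp_Ropp, <- exp_plus. f_equal. ring.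
Qed.

Lemma exp_quotient_limit (lambda : R) :
  filterlim (fun h => / h * (exp (lambda * h) - 1)) (at_right 0) (locally lambda).
Proof.
  assert (Hd : derivable_pt_lim (fun h => exp (lambda * h)) 0 lambda).
  { apply is_derive_Reals. auto_derive; [trivial|]. rewrite Rmult_0_r, exp_0. ring. }
  apply (filterlim_locally (F := at_right 0)). intros eps.
  destruct (Hd eps (cond_pos eps)) as [d H]. exists d. intros h Hh Hh0.
  change (Rabs (h - 0) < d) in Hh. rewrite Rminus_0_r in Hh.
  specialize (H h (Rgt_not_eq _ _ Hh0) Hh).
  rewrite Rplus_0_l, Rmult_0_r, exp_0 in H.
  change (Rabs (/ h * (exp (lambda * h) - 1) - lambda) < eps).
  now rewrite Rmult_comm.
Qed.

Lemma exp_limit_one (lambda : R) :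
  filterlim (fun h => exp (lambda * h)) (at_right 0) (locally 1).
Proof.
  rewrite <- exp_0. rewrite <- (Rmult_0_r lambda) at 2.
  apply (filterlim_filter_le_1 (F := locally 0)); [apply filter_le_within|].
  apply (exp_continuous lambda 0).
Qed.

Lemma laplace_quotient_limit (lambda : R) (f : R -> X) (T : R) :
  half_continuous f -> 0 <= T ->
  filterlim (fun h => scal (/ h) (minus (laplace lambda f (T + h)) (laplace lambda f T)))
    (at_right 0) (locally (scal (exp (- lambda * T)) (f T))).
Proof.
  intros Hf HT.
  apply filterlim_ext_loc with
    (fun h => scal (/ h) (RInt (fun s => scal (exp (- lambda * s)) (f s)) T (T + h))).
  - exists (mkposreal 1 Rlt_0_1). intros h _ Hh. f_equal. apply is_RInt_unique.
    apply laplace_minus; [exact Hf|lra|lra].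
  - apply (half_continuous_average (fun s => scal (exp (- lambda * s)) (f s)));
      [now apply half_continuous_exp|exact HT].
Qed.

Lemma laplace_zero (lambda : R) (f : R -> X) : laplace lambda f 0 = zero.
Proof. exact (RInt_point 0 _). Qed.

(** Product rule at [h = 0]: the exponential contributes [scal lambda w], the upper end of the
    integral [e], the lower end [- v]. In the applications [E h] is either the transform at [T + h],
    with [e] its integrand at [T], or a constant limit, with [e = zero]. *)
Lemma laplace_shift_quotient_limit (lambda : R) (f : R -> X) (E : R -> X) (w e v : X) :
  half_continuous f -> f 0 = v ->
  filterlim (fun h => scal (/ h) (minus (E h) w)) (at_right 0) (locally e) ->
  filterlim (fun h => scal (/ h)
      (minus (scal (exp (lambda * h)) (minus (E h) (laplace lambda f h))) w))
    (at_right 0) (locally (minus (plus (scal lambda w) e) v)).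
Proof.
  intros Hf <- HE.
  apply filterlim_ext_loc with (fun h =>
    plus (scal (/ h * (exp (lambda * h) - 1)) w)
      (scal (exp (lambda * h)) (minus (scal (/ h) (minus (E h) w))
         (scal (/ h) (minus (laplace lambda f (0 + h)) (laplace lambda f 0)))))).
  - exists (mkposreal 1 Rlt_0_1). intros h _ Hh. rewrite Rplus_0_l, laplace_zero. vec.
  - replace (minus (plus (scal lambda w) e) (f 0)) with
      (plus (scal lambda w) (scal 1 (minus e (scal (exp (- lambda * 0)) (f 0))))).
    + apply filterlim_plus_fun; [exact _| |].
      * apply filterlim_scal_fun; [exact _|apply exp_quotient_limit|apply filterlim_const].
      * apply filterlim_scal_fun; [exact _|apply exp_limit_one|].
        apply filterlim_minus_fun; [exact _|exact HE|].
        apply laplace_quotient_limit; [exact Hf|lra].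
    + rewrite Rmult_0_r, exp_0. vec.
Qed.

(** Comparison with the integral of [K * exp (- lambda * s)] over [[S, T]]; its term at [T] is
    dropped, which makes the bound uniform in [T]. *)
Lemma norm_laplace_minus (lambda K : R) (f : R -> X) (S T : R) :
  half_continuous f -> 0 < lambda -> (forall s, 0 <= s -> norm (f s) <= K) ->
  0 <= S <= T ->
  norm (minus (laplace lambda f T) (laplace lambda f S)) <=
    K / lambda * exp (- lambda * S).
Proof.
  intros Hf Hl HK HST.
  assert (HK0 : 0 <= K).
  { apply Rle_trans with (norm (f 0)); [apply norm_ge_0|apply HK; lra]. }
  apply Rle_trans with (K / lambda * exp (- lambda * S) - K / lambda * exp (- lambda * T)).
  - apply (norm_RInt_le (fun s => scal (exp (- lambda * s)) (f s))
      (fun s => exp (- lambda * s) * K) S T); [lra| | |].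
    + intros s Hs. rewrite norm_scal_eq, Rabs_pos_eq by apply Rlt_le, exp_pos.
      apply Rmult_le_compat_l; [apply Rlt_le, exp_pos|]. apply HK. lra.
    + apply laplace_minus; [exact Hf|lra|lra].
    + replace (K / lambda * exp (- lambda * S) - K / lambda * exp (- lambda * T)) with
        (minus ((fun s => - (K / lambda * exp (- lambda * s))) T)
               ((fun s => - (K / lambda * exp (- lambda * s))) S))
        by (unfold minus, plus, opp; simpl; ring).
      apply (is_RInt_derive (fun s => - (K / lambda * exp (- lambda * s)))).
      * intros s _. auto_derive; [trivial|]. field. lra.
      * intros s _. apply (ex_derive_continuous (fun s => exp (- lambda * s) * K)).
        auto_derive. trivial.
  - assert (0 <= K / lambda * exp (- lambda * T)); [|lra].
    apply Rmult_le_pos; [|apply Rlt_le, exp_pos].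
    apply Rmult_le_pos; [exact HK0|]. apply Rlt_le. now apply Rinv_0_lt_compat.
Qed.

Lemma exp_decay (lambda : R) :
  0 < lambda -> filterlim (fun t => exp (- lambda * t)) (Rbar_locally p_infty) (locally 0).
Proof.
  intros Hl. apply (filterlim_locally (F := Rbar_locally p_infty)). intros eps.
  exists (- ln eps / lambda). intros t Ht.
  change (Rabs (exp (- lambda * t) - 0) < eps).
  rewrite Rminus_0_r, Rabs_pos_eq by apply Rlt_le, exp_pos.
  rewrite <- (exp_ln eps) by apply cond_pos. apply exp_increasing.
  apply (Rmult_lt_compat_l lambda) in Ht; [|exact Hl].
  replace (lambda * (- ln eps / lambda)) with (- ln eps) in Ht by (field; lra). lra.
Qed.

Lemma exp_decay_scal (lambda K : R) :
  0 < lambda ->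
  filterlim (fun t => K * exp (- lambda * t)) (Rbar_locally p_infty) (locally 0).
Proof.
  intros Hl. rewrite <- (Rmult_0_r K).
  eapply filterlim_comp; [apply (exp_decay lambda Hl)|].
  apply (filterlim_scal_r (K := R_AbsRing) (V := R_NormedModule) K 0).
Qed.

Lemma exp_decay_bounded (lambda K : R) (f : R -> X) :
  0 < lambda -> (forall s, 0 <= s -> norm (f s) <= K) ->
  filterlim (fun t => scal (exp (- lambda * t)) (f t)) (Rbar_locally p_infty)
    (locally (zero : X)).
Proof.
  intros Hl HK.
  apply filterlim_norm_le with (g := fun t => K * exp (- lambda * t));
    [exact _| |now apply exp_decay_scal].
  exists 0. intros t Ht. replace (minus _ _) with (scal (exp (- lambda * t)) (f t)) by vec.
  rewrite norm_scal_eq, Rabs_pos_eq, Rmult_comm by apply Rlt_le, exp_pos.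
  apply Rmult_le_compat_r; [apply Rlt_le, exp_pos|]. apply HK. lra.
Qed.

Lemma laplace_converges (lambda K : R) (f : R -> X) :
  half_continuous f -> 0 < lambda -> (forall s, 0 <= s -> norm (f s) <= K) ->
  exists L : X, filterlim (laplace lambda f) (Rbar_locally p_infty) (locally L).
Proof.
  intros Hf Hl HK.
  apply (filterlim_locally_cauchy (F := Rbar_locally p_infty) (laplace lambda f)).
  intros eps.
  assert (He : 0 < eps / 2) by (pose proof (cond_pos eps); lra).
  destruct (proj1 (filterlim_locally _ _) (exp_decay_scal lambda (K / lambda) Hl)
    (mkposreal _ He)) as [N HN].
  (* Beyond [S] every transform is within [eps / 2] of the one at [S]; the added [1] makes [S]
     exceed [N] strictly. *)
  set (S := Rmax N 0 + 1).
  pose proof (Rmax_l N 0). pose proof (Rmax_r N 0).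
  specialize (HN S ltac:(unfold S; lra)).
  change (Rabs (K / lambda * exp (- lambda * S) - 0) < eps / 2) in HN.
  rewrite Rminus_0_r in HN. apply Rabs_def2 in HN. destruct HN as [HN _].
  exists (fun T => S < T). split; [now exists S|]. intros T1 T2 H1 H2.
  apply (norm_compat1 (laplace lambda f T1)).
  apply Rle_lt_trans with (1 := norm_minus_triangle _ (laplace lambda f S) _).
  rewrite (norm_minus_sym (laplace lambda f S)).
  pose proof (norm_laplace_minus lambda K f S T1 Hf Hl HK ltac:(unfold S in *; lra)).
  pose proof (norm_laplace_minus lambda K f S T2 Hf Hl HK ltac:(unfold S in *; lra)).
  lra.
Qed.

Lemma p_infty_shift (h : R) :
  filterlim (fun T => T + h) (Rbar_locally p_infty) (Rbar_locally p_infty).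
Proof.
  intros P [N HN]. exists (N - h). intros T HT. apply HN. lra.
Qed.

Lemma p_infty_nonneg : Rbar_locally p_infty (fun T => 0 <= T).
Proof. exists 0. intros T HT. lra. Qed.

End HalfLine.

(** * Families of bounded operators *)

Section Families.
Context {X : CompleteNormedModule R_AbsRing}.

(** The modulus [d] is uniform in [t]: an increment to the left of [t] is an increment to the right
    of an earlier time, so this one-sided modulus gives two-sided continuity. The uniform bound
    carries the modulus from a dense set to the whole space. *)
Record regular_family (W : R -> X -> X) : Prop := {
  family_linear : forall t, 0 <= t -> is_linear (W t);
  family_bounded : exists K, 0 < K /\
    forall t u, 0 <= t -> norm (W t u) <= K * norm u;
  family_uniform : forall u eps, 0 < eps -> exists d, 0 < d /\
    forall t h, 0 <= t -> 0 <= h < d -> norm (minus (W (t + h) u) (W t u)) < eps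
}.

Lemma regular_half_continuous (W : R -> X -> X) (u : X) :
  regular_family W -> half_continuous (fun t => W t u).
Proof.
  intros HW. apply half_continuous_norm. intros t Ht eps Heps.
  destruct (family_uniform W HW u eps Heps) as (d & Hd & H). exists d.
  split; [exact Hd|]. intros s Hs Hst. apply Rabs_def2 in Hst.
  destruct (Rle_lt_dec t s).
  - replace s with (t + (s - t)) by ring. apply H; lra.
  - rewrite norm_minus_sym. replace t with (s + (t - s)) by ring. apply H; lra.
Qed.

Lemma regular_family_of_dense (W : R -> X -> X) (D : X -> Prop) :
  (forall t, 0 <= t -> is_linear (W t)) ->
  (exists K, 0 < K /\ forall t u, 0 <= t -> norm (W t u) <= K * norm u) ->
  (forall u eps, 0 < eps -> exists v, D v /\ norm (minus v u) < eps) ->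
  (forall u eps, D u -> 0 < eps -> exists d, 0 < d /\
    forall t h, 0 <= t -> 0 <= h < d -> norm (minus (W (t + h) u) (W t u)) < eps) ->
  regular_family W.
Proof.
  intros Hlin Hbd Hdense Hunif. constructor; [exact Hlin|exact Hbd|].
  intros u eps Heps. destruct Hbd as (K & HK & Hbd).
  destruct (Hdense u (eps / (4 * K))) as (v & Hv & Hvu).
  { apply Rdiv_lt_0_compat; lra. }
  destruct (Hunif v (eps / 2) Hv) as (d & Hd & H); [lra|].
  exists d. split; [exact Hd|]. intros t h Ht Hh. specialize (H t h Ht Hh).
  assert (Hclose : forall s, 0 <= s -> norm (minus (W s v) (W s u)) <= eps / 4).
  { intros s Hs. rewrite <- (linear_minus (W s)) by (apply Hlin; exact Hs).
    apply Rle_trans with (1 := Hbd s _ Hs).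
    replace (eps / 4) with (K * (eps / (4 * K))) by (field; lra).
    apply Rmult_le_compat_l; [lra|apply Rlt_le; exact Hvu]. }
  pose proof (Hclose (t + h) ltac:(lra)) as H1. pose proof (Hclose t Ht) as H2.
  rewrite norm_minus_sym in H1.
  eapply Rle_lt_trans; [apply (norm_minus_triangle _ (W (t + h) v))|].
  pose proof (norm_minus_triangle (W (t + h) v) (W t v) (W t u)). lra.
Qed.

Lemma is_linear_ext_dense (l m : X -> X) (D : X -> Prop) :
  is_linear l -> is_linear m ->
  (forall u eps, 0 < eps -> exists v, D v /\ norm (minus v u) < eps) ->
  (forall u, D u -> l u = m u) -> forall u, l u = m u.
Proof.
  intros Hl Hm Hdense Heq u.
  destruct (linear_norm l Hl) as (K & HK & Hbl).
  destruct (linear_norm m Hm) as (K' & HK' & Hbm).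
  apply minus_eq_zero_norm. apply Rle_antisym; [|apply norm_ge_0].
  apply le_epsilon. intros eps Heps.
  destruct (Hdense u (eps / (K + K'))) as (v & Hv & Hvu).
  { apply Rdiv_lt_0_compat; lra. }
  apply Rle_trans with (1 := norm_minus_triangle _ (l v) _).
  rewrite (Heq v Hv) at 2. rewrite norm_minus_sym.
  rewrite <- (linear_minus l), <- (linear_minus m) by assumption.
  pose proof (Hbl (minus v u)). pose proof (Hbm (minus v u)).
  assert (K * norm (minus v u) + K' * norm (minus v u) <= eps).
  { replace eps with ((K + K') * (eps / (K + K'))) by (field; lra).
    rewrite <- Rmult_plus_distr_r. apply Rmult_le_compat_l; [lra|apply Rlt_le; exact Hvu]. }
  norm_lra.
Qed.

Lemma is_linear_sum_n (l : nat -> X -> X) (n : nat) :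
  (forall k, (k <= n)%nat -> is_linear (l k)) ->
  is_linear (fun u => sum_n (fun k => l k u) n).
Proof.
  induction n as [|n IH]; intros H.
  - apply is_linear_ext with (l 0%nat); [intros u; now rewrite sum_O|now apply H].
  - apply is_linear_ext with (fun u => plus (sum_n (fun k => l k u) n) (l (S n) u)).
    + intros u. now rewrite sum_Sn.
    + assert (H1 : is_linear (fun u => sum_n (fun k => l k u) n))
        by (apply IH; intros; apply H; lia).
      assert (H2 : is_linear (l (S n))) by (now apply H).
      destruct (linear_norm _ H1) as (K1 & HK1 & Hb1).
      destruct (linear_norm _ H2) as (K2 & HK2 & Hb2).
      constructor.
      * intros u v. rewrite (linear_plus _ H1 u v), (linear_plus _ H2 u v). vec.
      * intros a u. rewrite (linear_scal _ H1 a u), (linear_scal _ H2 a u). vec.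
      * exists (K1 + K2). split; [lra|]. intros u.
        eapply Rle_trans; [apply norm_plus_le|].
        specialize (Hb1 u). specialize (Hb2 u). simpl in *. lra.
Qed.

Lemma is_RInt_sum_n (f : nat -> R -> X) (a b : R) (I : nat -> X) (n : nat) :
  (forall k, (k <= n)%nat -> is_RInt (f k) a b (I k)) ->
  is_RInt (fun s => sum_n (fun k => f k s) n) a b (sum_n I n).
Proof.
  induction n as [|n IH]; intros H.
  - rewrite sum_O. apply is_RInt_ext with (f 0%nat); [|now apply H].
    intros s _. now rewrite sum_O.
  - rewrite sum_Sn.
    apply is_RInt_ext with (fun s => plus (sum_n (fun k => f k s) n) (f (S n) s)).
    + intros s _. now rewrite sum_Sn.
    + apply is_RInt_plus_fun; [apply IH; intros; apply H; lia|now apply H].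
Qed.

(* The coefficientwise form of the semigroup law of [\sum_n z^n W n t], a
   formal power series in [z]. *)
Definition convolution_law (W : nat -> R -> X -> X) (n : nat) : Prop :=
  forall t h u, 0 <= t -> 0 <= h ->
    W n (t + h) u = sum_n (fun k => W k t (W (n - k)%nat h u)) n.

(** The law for [W n (h + s) u] is integrated in [s] against the exponential weight: the bounded
    operators [W k h] pass through the integral, and the integral of [W n (h + s) u] is a shifted
    transform. *)
Lemma laplace_convolution (W : nat -> R -> X -> X) (n : nat) (lambda : R) (u : X)
    (h T : R) :
  (forall k, (k <= n)%nat -> regular_family (W k)) -> convolution_law W n ->
  0 <= h -> 0 <= T ->
  sum_n (fun k => W k h (laplace lambda (fun s => W (n - k)%nat s u) T)) n =
  scal (exp (lambda * h)) (minus (laplace lambda (fun s => W n s u) (T + h))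
    (laplace lambda (fun s => W n s u) h)).
Proof.
  intros HW Hlaw Hh HT.
  assert (Hsum : is_RInt (fun s => sum_n (fun k =>
      W k h (scal (exp (- lambda * s)) (W (n - k)%nat s u))) n) 0 T
    (sum_n (fun k => W k h (laplace lambda (fun s => W (n - k)%nat s u) T)) n)).
  { apply (is_RInt_sum_n (fun k s =>
      W k h (scal (exp (- lambda * s)) (W (n - k)%nat s u)))).
    intros k Hk. apply (is_RInt_linear (W k h)).
    - apply (family_linear _ (HW k Hk)). exact Hh.
    - apply is_RInt_laplace; [|exact HT]. apply regular_half_continuous. apply HW. lia. }
  apply is_RInt_unique in Hsum. rewrite <- Hsum. apply is_RInt_unique.
  pose proof (is_RInt_laplace_shift lambda (fun s => W n s u) h T
    (regular_half_continuous _ _ (HW n (le_n n))) Hh HT) as H.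
  apply is_RInt_ext with (2 := H). intros s Hs.
  rewrite Rmin_left, Rmax_right in Hs by exact HT.
  rewrite (Rplus_comm s h), Hlaw by lra.
  rewrite <- (sum_n_scal_l (V := CompleteNormedModule.ModuleSpace R_AbsRing X)).
  apply sum_n_ext_loc. intros k Hk. symmetry.
  apply (linear_scal (W k h)). apply (family_linear _ (HW k Hk)). exact Hh.
Qed.

(** Limit of the truncated identity: the transforms at [T] and at [T + h] have the same limit as [T]
    tends to infinity. *)
Lemma laplace_limit_convolution (W : nat -> R -> X -> X) (n : nat) (lambda : R) (u : X)
    (L : nat -> X) (h : R) :
  (forall k, (k <= n)%nat -> regular_family (W k)) -> convolution_law W n ->
  (forall k, (k <= n)%nat ->
    filterlim (laplace lambda (fun s => W k s u)) (Rbar_locally p_infty) (locally (L k))) ->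
  0 <= h ->
  sum_n (fun k => W k h (L (n - k)%nat)) n =
  scal (exp (lambda * h)) (minus (L n) (laplace lambda (fun s => W n s u) h)).
Proof.
  intros HW Hlaw HL Hh.
  apply (filterlim_locally_unique (F := Rbar_locally p_infty)
    (fun T => sum_n (fun k => W k h (laplace lambda (fun s => W (n - k)%nat s u) T)) n)).
  - apply (filterlim_sum_n (Rbar_locally p_infty)
      (fun k T => W k h (laplace lambda (fun s => W (n - k)%nat s u) T))).
    intros k Hk. eapply filterlim_comp; [apply (HL (n - k)%nat); lia|].
    apply (linear_cont (W k h)). apply (family_linear _ (HW k Hk)). exact Hh.
  - apply filterlim_ext_loc with (fun T => scal (exp (lambda * h))
      (minus (laplace lambda (fun s => W n s u) (T + h))
         (laplace lambda (fun s => W n s u) h))).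
    + generalize p_infty_nonneg. apply filter_imp. intros T HT. symmetry.
      now apply laplace_convolution.
    + apply filterlim_scal_fun; [exact _|apply filterlim_const|].
      apply filterlim_minus_fun; [exact _| |apply filterlim_const].
      eapply filterlim_comp; [apply p_infty_shift|now apply HL].
Qed.

End Families.

(** * The semigroup and its generator *)

Section Semigroup.
Context (X : CompleteNormedModule R_AbsRing) (pos : X -> Prop).
Hypothesis hX : abstract_state_space X pos.

(** Contractivity is given on the cone; the bounded decomposition extends it to a bound on the whole
    space, with a constant that does not depend on [t]. *)
Lemma substochastic_bounded (W : R -> X -> X) :
  (forall t, 0 <= t -> is_linear (W t)) -> substochastic X pos W ->
  exists K, 0 < K /\ forall t u, 0 <= t -> norm (W t u) <= K * norm u.
Proof.
  intros Hlin HW. destruct (bounded_decomposition X pos hX) as (M & HM & Hdec).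
  exists M. split; [exact HM|]. intros t u Ht.
  destruct (Hdec u) as (v & w & Hv & Hw & Heq & Hle).
  rewrite Heq at 1. rewrite (linear_minus (W t)) by (now apply Hlin).
  eapply Rle_trans; [apply norm_minus_le|].
  destruct (HW t v Ht Hv), (HW t w Ht Hw). lra.
Qed.

Context (U : R -> X -> X) (DA : X -> Prop) (A : X -> X).
Hypothesis hU : C0_semigroup X U.
Hypothesis hUs : substochastic X pos U.
Hypothesis hA : is_generator X U DA A.

(** As [U (t + h) u - U t u = U t (U h u - u)], the modulus at time [0] and the uniform bound give
    one modulus for all [t]. *)
Lemma semigroup_regular : regular_family U.
Proof.
  destruct (substochastic_bounded U (sg_bounded X U hU) hUs) as (K & HK & Hbd).
  constructor; [exact (sg_bounded X U hU)|now exists K|].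
  intros u eps Heps.
  destruct (proj1 (filterlim_norm_iff (at_right 0) _ _) (sg_continuous X U hU u)
    (eps / K)) as [d Hd]; [now apply Rdiv_lt_0_compat|].
  exists d. split; [apply cond_pos|]. intros t h Ht Hh.
  destruct (Req_dec h 0) as [->|Hh0].
  { rewrite Rplus_0_r, norm_minus_diag. exact Heps. }
  rewrite (sg_plus X U hU) by lra. rewrite <- (linear_minus (U t)) by (now apply (sg_bounded X U hU)).
  apply Rle_lt_trans with (1 := Hbd t _ Ht).
  apply Rlt_le_trans with (K * (eps / K)); [|apply Req_le; field; lra].
  apply Rmult_lt_compat_l; [exact HK|]. apply Hd; [|lra].
  change (Rabs (h - 0) < d). rewrite Rminus_0_r, Rabs_pos_eq; lra.
Qed.

Lemma generator_intro (w y : X) :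
  filterlim (fun h => scal (/ h) (minus (U h w) w)) (at_right 0) (locally y) ->
  DA w /\ A w = y.
Proof.
  intros H. destruct hA as [h1 h2]. assert (HD : DA w) by (apply h1; now exists y).
  split; [exact HD|].
  exact (filterlim_locally_unique (F := at_right 0) _ _ _ (h2 w HD) H).
Qed.

Lemma generator_limit (w : X) : DA w ->
  filterlim (fun h => scal (/ h) (minus (U h w) w)) (at_right 0) (locally (A w)).
Proof. intros H. exact (proj2 hA w H). Qed.

Lemma generator_commute (l : X -> X) (u : X) :
  is_linear l -> (forall h, 0 <= h -> U h (l u) = l (U h u)) -> DA u ->
  DA (l u) /\ A (l u) = l (A u).
Proof.
  intros Hl Hcom Hu. apply generator_intro.
  apply filterlim_ext_loc with (fun h => l (scal (/ h) (minus (U h u) u))).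
  - exists (mkposreal 1 Rlt_0_1). intros h _ Hh.
    rewrite Hcom by lra. rewrite <- (linear_minus l) by exact Hl.
    apply (linear_scal l Hl).
  - eapply filterlim_comp; [now apply generator_limit|now apply (linear_cont l)].
Qed.

Lemma generator_semigroup (t : R) (u : X) :
  0 <= t -> DA u -> DA (U t u) /\ A (U t u) = U t (A u).
Proof.
  intros Ht Hu. apply (generator_commute (U t)); [now apply (sg_bounded X U hU)| |exact Hu].
  intros h Hh. rewrite <- !(sg_plus X U hU) by assumption. now rewrite Rplus_comm.
Qed.

Lemma generator_plus (u v : X) :
  DA u -> DA v -> DA (plus u v) /\ A (plus u v) = plus (A u) (A v).
Proof.
  intros Hu Hv. apply generator_intro.
  apply filterlim_ext_loc with (fun h => plus (scal (/ h) (minus (U h u) u))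
                                              (scal (/ h) (minus (U h v) v))).
  - exists (mkposreal 1 Rlt_0_1). intros h _ Hh.
    rewrite (linear_plus (U h)) by (apply (sg_bounded X U hU); lra). vec.
  - apply filterlim_plus_fun; [exact _|now apply generator_limit|now apply generator_limit].
Qed.

Lemma generator_scal (a : R) (u : X) :
  DA u -> DA (scal a u) /\ A (scal a u) = scal a (A u).
Proof.
  intros Hu. apply generator_intro.
  apply filterlim_ext_loc with (fun h => scal a (scal (/ h) (minus (U h u) u))).
  - exists (mkposreal 1 Rlt_0_1). intros h _ Hh.
    rewrite (linear_scal (U h)) by (apply (sg_bounded X U hU); lra). vec.
  - apply filterlim_scal_fun; [exact _|apply filterlim_const|now apply generator_limit].
Qed.

Lemma linear_on_minus (C : X -> X) (u v : X) :
  linear_on X DA C -> DA u -> DA v -> C (minus u v) = minus (C u) (C v).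
Proof.
  intros [Cplus Cscal] Hu Hv.
  replace (minus u v) with (plus u (scal (-1) v)) by vec.
  rewrite Cplus, Cscal; [vec|exact Hv|exact Hu|now apply generator_scal].
Qed.

Lemma generator_minus (u v : X) :
  DA u -> DA v -> DA (minus u v) /\ A (minus u v) = minus (A u) (A v).
Proof.
  intros Hu Hv. replace (minus u v) with (plus u (scal (-1) v)) by vec.
  destruct (generator_scal (-1) v Hv) as [Hv' Ev].
  destruct (generator_plus u _ Hu Hv') as [Hs Es]. split; [exact Hs|].
  rewrite Es, Ev. vec.
Qed.

(** * Integrals of orbits, density of the domain, and the resolvent at 1 *)

Lemma orbit_half_continuous (u : X) : half_continuous (fun t => U t u).
Proof. apply regular_half_continuous, semigroup_regular. Qed.

Lemma generator_laplace (lambda : R) (u : X) (T : R) :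
  0 <= T -> let L := laplace lambda (fun s => U s u) T in
  DA L /\ A L = minus (plus (scal lambda L) (scal (exp (- lambda * T)) (U T u))) u.
Proof.
  intros HT L. apply generator_intro.
  apply filterlim_ext_loc with (fun h => scal (/ h)
    (minus (scal (exp (lambda * h)) (minus (laplace lambda (fun s => U s u) (T + h))
       (laplace lambda (fun s => U s u) h))) L)).
  - exists (mkposreal 1 Rlt_0_1). intros h _ Hh. f_equal. f_equal.
    (* At order [0] the convolution law is the semigroup law. *)
    rewrite <- (laplace_convolution (fun _ => U) 0 lambda u h T).
    + now rewrite sum_O.
    + intros _ _. exact semigroup_regular.
    + intros t r v Ht Hr. rewrite sum_O. now apply (sg_plus X U hU).
    + lra.
    + exact HT.
  - apply (laplace_shift_quotient_limit lambda (fun s => U s u)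
      (fun h => laplace lambda (fun s => U s u) (T + h))).
    + apply orbit_half_continuous.
    + apply (sg_zero X U hU).
    + apply (laplace_quotient_limit lambda (fun s => U s u) T); [apply orbit_half_continuous|exact HT].
Qed.

Lemma generator_laplace_limit (lambda : R) (u L : X) :
  filterlim (laplace lambda (fun s => U s u)) (Rbar_locally p_infty) (locally L) ->
  DA L /\ A L = minus (scal lambda L) u.
Proof.
  intros HL.
  destruct (generator_intro L (minus (plus (scal lambda L) (zero : X)) u)) as [HD HL'];
    [|split; [exact HD|rewrite HL'; vec]].
  apply filterlim_ext_loc with (fun h => scal (/ h)
    (minus (scal (exp (lambda * h)) (minus L (laplace lambda (fun s => U s u) h))) L)).
  - exists (mkposreal 1 Rlt_0_1). intros h _ Hh. f_equal. f_equal.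
    rewrite <- (laplace_limit_convolution (fun _ => U) 0 lambda u (fun _ => L) h).
    + now rewrite sum_O.
    + intros _ _. exact semigroup_regular.
    + intros t r v Ht Hr. rewrite sum_O. now apply (sg_plus X U hU).
    + intros _ _. exact HL.
    + lra.
  - apply (laplace_shift_quotient_limit lambda (fun s => U s u) (fun _ => L)).
    + apply orbit_half_continuous.
    + apply (sg_zero X U hU).
    + apply filterlim_ext with (fun _ => zero); [intros h; vec|apply filterlim_const].
Qed.

(** Averages of an orbit over short intervals lie in the domain and approximate its starting point.
    They inherit positivity, which lets estimates for positive vectors of the domain pass to the
    whole cone. *)
Lemma domain_dense (u : X) (eps : R) : 0 < eps ->
  exists v, DA v /\ (pos u -> pos v) /\ norm (minus v u) < eps.
Proof.
  intros Heps.
  pose proof (laplace_quotient_limit 0 (fun s => U s u) 0 (orbit_half_continuous u)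
    (Rle_refl 0)) as H.
  cbv beta in H. rewrite (sg_zero X U hU) in H.
  apply filterlim_norm_iff with (eps := eps) in H; [|exact _|exact Heps].
  destruct H as [d Hd]. pose proof (cond_pos d) as Hd0.
  specialize (Hd (d / 2)). rewrite Rplus_0_l, laplace_zero in Hd.
  exists (scal (/ (d / 2)) (laplace 0 (fun s => U s u) (d / 2))). repeat split.
  - apply generator_scal. apply generator_laplace. lra.
  - intros Hu. apply (pos_scal X pos hX).
    { apply Rlt_le, Rinv_0_lt_compat. lra. }
    apply (is_RInt_in_cone pos (fun s => scal (exp (- 0 * s)) (U s u)) 0 (d / 2)).
    + exact hX.
    + lra.
    + intros s Hs. apply (pos_scal X pos hX); [apply Rlt_le, exp_pos|].
      apply hUs; [lra|exact Hu].
    + apply is_RInt_laplace; [apply orbit_half_continuous|lra].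
  - eapply Rle_lt_trans; [|apply Hd].
    + apply Req_le. f_equal. rewrite Rmult_0_r, exp_0. vec.
    + change (Rabs (d / 2 - 0) < d). rewrite Rminus_0_r, Rabs_pos_eq; lra.
    + lra.
Qed.

Lemma is_linear_laplace (lambda T : R) : 0 <= lambda -> 0 <= T ->
  is_linear (fun u => laplace lambda (fun s => U s u) T).
Proof.
  intros Hl HT. destruct (family_bounded U semigroup_regular) as (K & HK & Hbd).
  constructor.
  - intros u v. apply is_RInt_unique.
    apply is_RInt_ext with (fun s => plus (scal (exp (- lambda * s)) (U s u))
                                          (scal (exp (- lambda * s)) (U s v))).
    + intros s Hs. rewrite Rmin_left in Hs by exact HT.
      rewrite (linear_plus (U s)) by (apply (sg_bounded X U hU); lra). vec.
    + apply is_RInt_plus_fun; (apply is_RInt_laplace; [apply orbit_half_continuous|exact HT]).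
  - intros a u. apply is_RInt_unique.
    apply is_RInt_ext with (fun s => scal a (scal (exp (- lambda * s)) (U s u))).
    + intros s Hs. rewrite Rmin_left in Hs by exact HT.
      rewrite (linear_scal (U s)) by (apply (sg_bounded X U hU); lra). vec.
    + apply is_RInt_scal_fun; (apply is_RInt_laplace; [apply orbit_half_continuous|exact HT]).
  - exists (T * K + 1). split; [nra|]. intros u.
    apply Rle_trans with ((T - 0) * (K * norm u)).
    + apply (norm_RInt_le_const (fun s => scal (exp (- lambda * s)) (U s u)) 0 T);
        [exact HT| |apply is_RInt_laplace; [apply orbit_half_continuous|exact HT]].
      intros s Hs. rewrite norm_scal_eq, Rabs_pos_eq by apply Rlt_le, exp_pos.
      assert (exp (- lambda * s) <= 1).
      { rewrite <- exp_0. destruct (Rle_lt_or_eq_dec (- lambda * s) 0) as [Hlt|Heq].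
        - nra.
        - apply Rlt_le. now apply exp_increasing.
        - rewrite Heq. lra. }
      pose proof (exp_pos (- lambda * s)). pose proof (norm_ge_0 (U s u)).
      specialize (Hbd s u (proj1 Hs)). nra.
    + pose proof (norm_ge_0 u). nra.
Qed.

Lemma generator_laplace_commute (lambda : R) (u : X) (T : R) :
  0 <= lambda -> 0 <= T -> DA u ->
  A (laplace lambda (fun s => U s u) T) = laplace lambda (fun s => U s (A u)) T.
Proof.
  intros Hl HT Hu.
  apply (generator_commute (fun u => laplace lambda (fun s => U s u) T));
    [now apply is_linear_laplace| |exact Hu].
  intros h Hh. symmetry. apply is_RInt_unique.
  apply is_RInt_ext with (fun s => U h (scal (exp (- lambda * s)) (U s u))).
  - intros s Hs. rewrite Rmin_left in Hs by exact HT.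
    rewrite (linear_scal (U h)) by (apply (sg_bounded X U hU); lra).
    rewrite <- !(sg_plus X U hU) by lra. now rewrite Rplus_comm.
  - apply (is_RInt_linear (U h)); [now apply (sg_bounded X U hU)|].
    apply is_RInt_laplace; [apply orbit_half_continuous|exact HT].
Qed.

(** Two values of [A] on the integral of the orbit are compared: the boundary terms [U t u - u], and
    the integral with [A] moved inside by commutation. *)
Lemma is_RInt_semigroup_generator (u : X) (t : R) : 0 <= t -> DA u ->
  is_RInt (fun s => U s (A u)) 0 t (minus (U t u) u).
Proof.
  intros Ht Hu. destruct (generator_laplace 0 u t Ht) as [_ HA].
  rewrite generator_laplace_commute in HA by (assumption || lra).
  replace (minus (U t u) u) with (laplace 0 (fun s => U s (A u)) t).
  - apply is_RInt_ext with (fun s => scal (exp (- 0 * s)) (U s (A u))).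
    + intros s _. rewrite Ropp_0, Rmult_0_l, exp_0. vec.
    + apply is_RInt_laplace; [apply orbit_half_continuous|exact Ht].
  - rewrite HA, Ropp_0, Rmult_0_l, exp_0. vec.
Qed.

(** The truncated transform of the orbit of [u - A u] is exactly [u - exp (- T) U T u], and the last
    term decays. *)
Lemma resolvent_inverse (u : X) : DA u ->
  filterlim (laplace 1 (fun s => U s (minus u (A u)))) (Rbar_locally p_infty) (locally u).
Proof.
  intros Hu. destruct (family_bounded U semigroup_regular) as (K & HK & Hbd).
  apply filterlim_ext_loc with (fun T => minus u (scal (exp (- (1) * T)) (U T u))).
  - generalize p_infty_nonneg. apply filter_imp. intros T HT.
    destruct (generator_laplace 1 u T HT) as [_ HA].
    rewrite generator_laplace_commute in HA by (assumption || lra).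
    symmetry. etransitivity.
    { apply (linear_minus (fun u => laplace 1 (fun s => U s u) T) u (A u)).
      apply is_linear_laplace; lra. }
    cbv beta. rewrite HA. vec.
  - replace u with (minus u (zero : X)) at 1 by vec.
    apply filterlim_minus_fun; [exact _|apply filterlim_const|].
    apply (exp_decay_bounded 1 (K * norm u) (fun T => U T u)); [lra|].
    intros s Hs. now apply Hbd.
Qed.

(** * Relative boundedness of [B] with respect to [A] *)

Context (Psi : X -> R) (B : X -> X).
Hypothesis hPsi : norm_functional X pos Psi.
Hypothesis hBlin : linear_on X DA B.
Hypothesis hBpos : positive_on X pos DA B.
Hypothesis hAB : forall u : X, DA u -> pos u -> Psi (plus (A u) (B u)) <= 0.

Lemma Psi_plus (u v : X) : Psi (plus u v) = Psi u + Psi v.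
Proof. exact (linear_plus Psi (proj1 hPsi) u v). Qed.

Lemma Psi_minus (u v : X) : Psi (minus u v) = Psi u - Psi v.
Proof.
  unfold minus. rewrite Psi_plus. unfold Rminus. f_equal.
  exact (linear_opp Psi v (proj1 hPsi)).
Qed.

Lemma norm_perturbation_le (u : X) : DA u -> pos u -> norm (B u) <= - Psi (A u).
Proof.
  intros Hu Hp. rewrite <- (proj2 hPsi) by (now apply hBpos).
  pose proof (hAB u Hu Hp) as H. rewrite Psi_plus in H. lra.
Qed.

(** Splitting [u] itself could leave the domain, so [u - A u] is split instead, and the resolvent at
    1 sends both parts to positive vectors of the domain. If [L] is the resolvent of a positive [v],
    then [A L = L - v], hence [norm (B L) <= - Psi (A L) = norm v - norm L]. *)
Lemma perturbation_relatively_bounded :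
  exists C, 0 < C /\ forall u, DA u -> norm (B u) <= C * norm (minus u (A u)).
Proof.
  destruct (bounded_decomposition X pos hX) as (M & HM & Hdec).
  exists M. split; [exact HM|]. intros u Hu.
  assert (Hres : forall v, pos v -> exists L, DA L /\ norm (B L) <= norm v /\
    filterlim (laplace 1 (fun s => U s v)) (Rbar_locally p_infty) (locally L)).
  { intros v Hv.
    destruct (laplace_converges 1 (norm v) (fun s => U s v)) as [L HL];
      [apply orbit_half_continuous|lra|intros s Hs; now apply hUs|].
    destruct (generator_laplace_limit 1 v L HL) as [HD HA].
    assert (Lpos : pos L).
    { apply (closed_filterlim_loc (F := Rbar_locally p_infty) _ pos L HL);
        [|exact (pos_closed X pos hX)].
      generalize p_infty_nonneg. apply filter_imp. intros T HT.
      apply (is_RInt_in_cone pos (fun s => scal (exp (- (1) * s)) (U s v)) 0 T).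
      - exact hX.
      - exact HT.
      - intros s Hs. apply (pos_scal X pos hX); [apply Rlt_le, exp_pos|].
        apply hUs; [lra|exact Hv].
      - apply is_RInt_laplace; [apply orbit_half_continuous|lra]. }
    exists L. split; [exact HD|]. split; [|exact HL].
    apply Rle_trans with (1 := norm_perturbation_le L HD Lpos).
    rewrite HA. replace (scal 1 L) with L by vec. rewrite Psi_minus.
    rewrite !(proj2 hPsi) by assumption. pose proof (norm_ge_0 L). lra. }
  destruct (Hdec (minus u (A u))) as (v & w & Hv & Hw & Heq & Hle).
  destruct (Hres v Hv) as (Lv & HDv & HBv & HLv).
  destruct (Hres w Hw) as (Lw & HDw & HBw & HLw).
  assert (Hu' : u = minus Lv Lw).
  { apply (filterlim_locally_unique (F := Rbar_locally p_infty)
      (laplace 1 (fun s => U s (minus u (A u))))); [now apply resolvent_inverse|].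
    rewrite Heq.
    apply filterlim_ext_loc with
      (fun T => minus (laplace 1 (fun s => U s v) T) (laplace 1 (fun s => U s w) T)).
    - generalize p_infty_nonneg. apply filter_imp. intros T HT. symmetry.
      apply (linear_minus (fun u => laplace 1 (fun s => U s u) T)).
      apply is_linear_laplace; lra.
    - apply filterlim_minus_fun; [exact _|exact HLv|exact HLw]. }
  rewrite Hu' at 1. rewrite (linear_on_minus B) by assumption.
  eapply Rle_trans; [apply norm_minus_le|]. lra.
Qed.

End Semigroup.

(** * Dyson-Phillips iterates *)

Lemma sum_n_shift {G : AbelianMonoid} (f : nat -> G) (n : nat) :
  sum_n f (S n) = plus (f 0%nat) (sum_n (fun k => f (S k)) n).
Proof.
  induction n as [|n IH].
  - now rewrite sum_Sn, !sum_O.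
  - rewrite sum_Sn, IH, sum_Sn. symmetry. apply plus_assoc.
Qed.

Lemma sum_n_eq_zero {G : AbelianMonoid} (f : nat -> G) (n : nat) :
  (forall k, (k <= n)%nat -> f k = zero) -> sum_n f n = zero.
Proof.
  induction n as [|n IH]; intros H.
  - rewrite sum_O. now apply H.
  - rewrite sum_Sn, IH, H by (intros; try apply H; lia). apply plus_zero_l.
Qed.

Section DysonPhillips.
Context (X : CompleteNormedModule R_AbsRing) (pos : X -> Prop).
Hypothesis hX : abstract_state_space X pos.
Context (U : R -> X -> X) (DA : X -> Prop) (A : X -> X).
Hypothesis hU : C0_semigroup X U.
Hypothesis hUs : substochastic X pos U.
Hypothesis hA : is_generator X U DA A.
Context (Psi : X -> R) (B : X -> X).
Hypothesis hPsi : norm_functional X pos Psi.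
Hypothesis hBlin : linear_on X DA B.
Hypothesis hBpos : positive_on X pos DA B.
Hypothesis hAB : forall u : X, DA u -> pos u -> Psi (plus (A u) (B u)) <= 0.
Context (V : nat -> R -> X -> X).
Hypothesis hV : Dyson_Phillips X U DA B V.

Let V_linear (n : nat) (t : R) : 0 <= t -> is_linear (V n t).
Proof. exact (DP_bounded X U DA B V hV n t). Qed.

Let U_linear (t : R) : 0 <= t -> is_linear (U t).
Proof. exact (sg_bounded X U hU t). Qed.

Let dense (u : X) (eps : R) : 0 < eps -> exists v, DA v /\ norm (minus v u) < eps.
Proof.
  intros Heps. destruct (domain_dense X pos hX U DA A hU hUs hA u eps Heps)
    as (v & Hv & _ & H). now exists v.
Qed.

Let domain_semigroup (t : R) (u : X) :
  0 <= t -> DA u -> DA (U t u) /\ A (U t u) = U t (A u).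
Proof. exact (generator_semigroup X U DA A hU hA t u). Qed.

Let linear_B_minus (u v : X) : DA u -> DA v -> B (minus u v) = minus (B u) (B v).
Proof. exact (linear_on_minus X U DA A hU hA B u v hBlin). Qed.

Let B_bounded :
  exists C, 0 < C /\ forall u, DA u -> norm (B u) <= C * norm (minus u (A u)).
Proof.
  exact (perturbation_relatively_bounded X pos hX U DA A hU hUs hA Psi B hPsi
    hBlin hBpos hAB).
Qed.

(** [V n] contracts the positive vectors [B (U s u)], and [norm (B (U s u)) <= - Psi (U s (A u))],
    whose integral over [[0, t]] is [- Psi (U t u - u) = norm u - norm (U t u)]. *)
Lemma iterate_domain_contraction (n : nat) (t : R) (u : X) :
  substochastic X pos (V n) -> 0 <= t -> DA u -> pos u ->
  pos (V (S n) t u) /\ norm (V (S n) t u) <= norm u.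
Proof.
  intros Hn Ht Hu Hp. pose proof (DP_succ X U DA B V hV n t u Ht Hu) as HI.
  assert (HB : forall s, 0 <= s -> pos (B (U s u))).
  { intros s Hs. apply hBpos; [now apply domain_semigroup|now apply hUs]. }
  split.
  - apply (is_RInt_in_cone pos _ 0 t _ hX Ht) with (2 := HI).
    intros s Hs. apply Hn; [lra|]. apply HB. lra.
  - apply Rle_trans with (- Psi (minus (U t u) u)).
    + apply (norm_RInt_le (fun s => V n (t - s) (B (U s u)))
        (fun s => - Psi (U s (A u))) 0 t); [exact Ht| |exact HI|].
      * intros s Hs. destruct (domain_semigroup s u) as [HD HE]; [lra|exact Hu|].
        apply Rle_trans with (norm (B (U s u))).
        { apply Hn; [lra|]. apply HB. lra. }
        rewrite <- HE.
        apply (norm_perturbation_le X pos DA A Psi B hPsi hBpos hAB); [exact HD|].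
        apply hUs; [lra|exact Hp].
      * apply (is_RInt_opp (V := R_NormedModule) (fun s => Psi (U s (A u)))).
        apply (is_RInt_linear Psi (fun s => U s (A u))); [apply hPsi|].
        now apply (is_RInt_semigroup_generator X pos hX U DA A).
    + rewrite (Psi_minus X pos Psi hPsi). destruct (hUs t u Ht Hp).
      rewrite !(proj2 hPsi) by assumption. pose proof (norm_ge_0 (U t u)). lra.
Qed.

Lemma iterate_substochastic (n : nat) : substochastic X pos (V n).
Proof.
  induction n as [|n IH].
  - intros t u Ht Hu. rewrite (DP_zero X U DA B V hV) by exact Ht. now apply hUs.
  - intros t u Ht Hu. pose proof (V_linear (S n) t Ht) as Hlin. split.
    (* [closed] asks to refute that a neighbourhood of the image misses the cone: by continuity it
       would contain the image of a positive vector of the domain close to [u]. *)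
    + apply (pos_closed X pos hX). intros Hloc.
      pose proof (linear_cont (V (S n) t) u Hlin _ Hloc) as Hu'.
      destruct (locally_norm_le_locally u _ Hu') as [eps Heps].
      destruct (domain_dense X pos hX U DA A hU hUs hA u eps (cond_pos eps))
        as (v & Hv & Hvp & Hvu).
      apply (Heps v Hvu). apply iterate_domain_contraction; auto.
    + destruct (linear_norm _ Hlin) as (K & HK & Hbd).
      apply le_epsilon. intros eps Heps.
      (* In [K + 1], [K] accounts for the images of [u] and [v], and [1] for [norm v] against
         [norm u]. *)
      destruct (domain_dense X pos hX U DA A hU hUs hA u (eps / (K + 1)))
        as (v & Hv & Hvp & Hvu); [apply Rdiv_lt_0_compat; lra|].
      destruct (iterate_domain_contraction n t v IH Ht Hv (Hvp Hu)) as [_ Hc].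
      pose proof (norm_le_minus (V (S n) t u) (V (S n) t v)) as H1.
      rewrite <- (linear_minus (V (S n) t)) in H1 by exact Hlin.
      pose proof (Hbd (minus u v)) as H2. pose proof (norm_le_minus v u) as H3.
      rewrite (norm_minus_sym u v) in H2. rewrite (norm_minus_sym v u) in H2.
      rewrite (norm_minus_sym u v) in H2.
      assert (K * norm (minus v u) + norm (minus v u) <= eps).
      { replace eps with ((K + 1) * (eps / (K + 1))) by (field; lra).
        rewrite <- (Rmult_1_l (norm (minus v u))) at 2.
        rewrite <- Rmult_plus_distr_r. apply Rmult_le_compat_l; [lra|].
        apply Rlt_le. exact Hvu. }
      norm_lra.
Qed.

Lemma iterate_bounded (n : nat) :
  exists K, 0 < K /\ forall t u, 0 <= t -> norm (V n t u) <= K * norm u.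
Proof.
  apply (substochastic_bounded X pos hX); [apply V_linear|apply iterate_substochastic].
Qed.

(** The integral for [V (S n) (t + h) u] is cut at [h]; on [[h, t + h]] the substitution of [s + h],
    with [U (s + h) u = U s (U h u)], produces the formula for [V (S n) t (U h u)]. The other piece
    has length [h], whence continuity and differentiability in time. *)
Lemma iterate_shift (n : nat) (t h : R) (u : X) : 0 <= t -> 0 <= h -> DA u ->
  is_RInt (fun s => V n (t + h - s) (B (U s u))) 0 h
    (minus (V (S n) (t + h) u) (V (S n) t (U h u))).
Proof.
  intros Ht Hh Hu. set (F := fun s => V n (t + h - s) (B (U s u))).
  assert (HI : is_RInt F 0 (t + h) (V (S n) (t + h) u))
    by (apply (DP_succ X U DA B V hV); [lra|exact Hu]).
  assert (Hex : ex_RInt F 0 (t + h)) by (now exists (V (S n) (t + h) u)).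
  assert (H1 : ex_RInt F 0 h) by (apply (ex_RInt_Chasles_1 F 0 h (t + h)); [lra|exact Hex]).
  assert (H2 : ex_RInt F h (t + h))
    by (apply (ex_RInt_Chasles_2 F 0 h (t + h)); [lra|exact Hex]).
  assert (HJ : V (S n) t (U h u) = RInt F h (t + h)).
  { pose proof (DP_succ X U DA B V hV n t (U h u) Ht
      (proj1 (domain_semigroup h u Hh Hu))) as H.
    apply is_RInt_unique in H. rewrite <- H. apply is_RInt_unique.
    pose proof (RInt_correct F h (t + h) H2) as H3.
    replace h with (1 * 0 + h) in H3 at 1 by ring.
    replace (t + h) with (1 * t + h) in H3 at 1 by ring.
    apply is_RInt_comp_lin in H3. apply is_RInt_ext with (2 := H3).
    intros s Hs. rewrite Rmin_left in Hs by exact Ht.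
    unfold F. rewrite <- (sg_plus X U hU) by lra.
    replace (t + h - (1 * s + h)) with (t - s) by ring.
    replace (1 * s + h) with (s + h) by ring. vec. }
  rewrite HJ. apply is_RInt_unique in HI. rewrite <- HI.
  rewrite <- (RInt_Chasles F 0 h (t + h) H1 H2).
  replace (minus (plus (RInt F 0 h : X) (RInt F h (t + h))) (RInt F h (t + h)))
    with (RInt F 0 h) by vec.
  now apply RInt_correct.
Qed.

(** [U s u - A (U s u) = U s (u - A u)] is bounded in [s], and the relative bound applies. *)
Lemma perturbed_orbit_bound (u : X) : DA u ->
  exists Q, 0 <= Q /\ forall s, 0 <= s -> norm (B (U s u)) <= Q.
Proof.
  intros Hu. destruct B_bounded as (C & HC & HB).
  destruct (family_bounded U (semigroup_regular X pos hX U hU hUs)) as (K & HK & HKb).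
  pose proof (norm_ge_0 (minus u (A u))) as Hn.
  exists (C * (K * norm (minus u (A u)))). split.
  { apply Rmult_le_pos; [lra|]. apply Rmult_le_pos; [lra|exact Hn]. }
  intros s Hs. destruct (domain_semigroup s u Hs Hu) as [HD HE].
  apply Rle_trans with (1 := HB _ HD). apply Rmult_le_compat_l; [lra|].
  rewrite HE, <- (linear_minus (U s)) by (now apply U_linear). now apply HKb.
Qed.

(** On the domain the increment of [V (S n)] splits into an integral over [[0, h]] of a bounded
    function and [V (S n) t (U h u - u)]; both are small uniformly in [t]. *)
Lemma iterate_regular (n : nat) : regular_family (V n).
Proof.
  apply regular_family_of_dense with DA;
    [apply V_linear|apply iterate_bounded|exact dense|].
  intros u eps Hu Heps.
  pose proof (semigroup_regular X pos hX U hU hUs) as HU. destruct n as [|n].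
  - destruct (family_uniform U HU u eps Heps) as (d & Hd & H). exists d.
    split; [exact Hd|]. intros t h Ht Hh.
    rewrite !(DP_zero X U DA B V hV) by lra. now apply H.
  - destruct (iterate_bounded n) as (K & HK & HKb).
    destruct (iterate_bounded (S n)) as (K' & HK' & HKb').
    destruct (perturbed_orbit_bound u Hu) as (Q & HQ & HQb).
    destruct (family_uniform U HU u (eps / (2 * K'))) as (d & Hd & H).
    { apply Rdiv_lt_0_compat; lra. }
    assert (HKQ : 0 <= K * Q) by (apply Rmult_le_pos; lra).
    set (e := eps / (2 * (K * Q + 1))).
    assert (He : 0 < e) by (apply Rdiv_lt_0_compat; lra).
    exists (Rmin d e). split; [now apply Rmin_pos|]. intros t h Ht Hh.
    pose proof (Rmin_l d e). pose proof (Rmin_r d e).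
    eapply Rle_lt_trans; [apply (norm_minus_triangle _ (V (S n) t (U h u)))|].
    assert (E1 : norm (minus (V (S n) (t + h) u) (V (S n) t (U h u))) <= (h - 0) * (K * Q)).
    { apply (norm_RInt_le_const (fun s => V n (t + h - s) (B (U s u))) 0 h);
        [lra| |now apply iterate_shift].
      intros s Hs. apply Rle_trans with (K * norm (B (U s u))); [apply HKb; lra|].
      apply Rmult_le_compat_l; [lra|]. apply HQb. lra. }
    assert (E2 : norm (minus (V (S n) t (U h u)) (V (S n) t u)) < eps / 2).
    { rewrite <- (linear_minus (V (S n) t)) by (now apply V_linear).
      apply Rle_lt_trans with (1 := HKb' t _ Ht).
      replace (eps / 2) with (K' * (eps / (2 * K'))) by (field; lra).
      apply Rmult_lt_compat_l; [exact HK'|].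
      specialize (H 0 h (Rle_refl 0)). rewrite Rplus_0_l, (sg_zero X U hU) in H.
      apply H. lra. }
    assert (E3 : (h - 0) * (K * Q) <= eps / 2).
    { apply Rle_trans with (e * (K * Q + 1)).
      - apply Rmult_le_compat; lra.
      - apply Req_le. unfold e. field. lra. }
    lra.
Qed.

(** The term [k = S n] is [V (S n) t (U h u)]; the others come from the law of order [n] for
    [B (U s u)] at times [t] and [h - s], integrated over [[0, h]]. As [B (U s u)] need not lie in
    the domain, each order has to be extended by density before the next one. *)
Lemma iterate_convolution_law (n : nat) : convolution_law V n.
Proof.
  induction n as [|n IH]; intros t h u Ht Hh.
  - rewrite sum_O. rewrite !(DP_zero X U DA B V hV) by (simpl; lra).
    now apply (sg_plus X U hU).
  - revert u. apply is_linear_ext_dense with DA.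
    + apply V_linear. lra.
    + apply (is_linear_sum_n (fun k u => V k t (V (S n - k)%nat h u))).
      intros k Hk. apply (is_linear_comp (V (S n - k)%nat h) (V k t)); now apply V_linear.
    + exact dense.
    + intros u Hu. rewrite sum_Sn. rewrite Nat.sub_diag.
      rewrite (DP_zero X U DA B V hV h) by exact Hh.
      pose proof (iterate_shift n t h u Ht Hh Hu) as HI.
      assert (HS : is_RInt (fun s => sum_n (fun k =>
          V k t (V (n - k)%nat (h - s) (B (U s u)))) n) 0 h
        (sum_n (fun k => V k t (V (S n - k)%nat h u)) n)).
      { apply (is_RInt_sum_n (fun k s => V k t (V (n - k)%nat (h - s) (B (U s u))))).
        intros k Hk. rewrite Nat.sub_succ_l by exact Hk.
        apply (is_RInt_linear (V k t)); [now apply V_linear|].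
        now apply (DP_succ X U DA B V hV). }
      apply is_RInt_unique in HS. apply is_RInt_unique in HI. rewrite <- HS.
      replace (RInt _ 0 h) with (minus (V (S n) (t + h) u) (V (S n) t (U h u))).
      * vec.
      * rewrite <- HI. apply RInt_ext. intros s Hs.
        rewrite Rmin_left, Rmax_right in Hs by exact Hh.
        replace (t + h - s) with (t + (h - s)) by ring. apply IH; lra.
Qed.

Definition initial_iterate (n : nat) (u : X) : X :=
  match n with O => u | S _ => zero end.

Lemma iterate_at_zero (n : nat) (u : X) : V n 0 u = initial_iterate n u.
Proof.
  destruct n as [|n]; simpl.
  - rewrite (DP_zero X U DA B V hV) by lra. apply (sg_zero X U hU).
  - revert u. apply is_linear_ext_dense with DA.
    + apply V_linear. lra.
    + exact is_linear_zero.
    + exact dense.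
    + intros u Hu. pose proof (DP_succ X U DA B V hV n 0 u (Rle_refl 0) Hu) as H.
      apply is_RInt_unique in H. rewrite <- H. exact (RInt_point 0 _).
Qed.

(** At time [0] the power series is the identity. Read from right to left, this writes a single
    vector as the sum of limits that difference quotients produce in [triangular_generator]. *)
Lemma sum_iterates_at_zero (x : nat -> X) (n : nat) :
  sum_n (fun k => V k 0 (x (n - k)%nat)) n = x n.
Proof.
  destruct n as [|n].
  - rewrite sum_O. apply (iterate_at_zero 0).
  - rewrite sum_n_shift, sum_n_eq_zero.
    + rewrite plus_zero_r. apply (iterate_at_zero 0).
    + intros k _. apply (iterate_at_zero (S k)).
Qed.

(** The increment is [I + V (S n) t (U h u - u)], where [I] is an integral over [[0, h]] with
    integrand close to [V n t (B u)]. Uniformity in [t] is what later yields the left derivative. *)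
Lemma iterate_difference (n : nat) (u : X) (eps : R) : DA u -> 0 < eps ->
  exists d, 0 < d /\ forall t h, 0 <= t -> 0 < h < d ->
    norm (minus (minus (V (S n) (t + h) u) (V (S n) t u))
            (scal h (plus (V (S n) t (A u)) (V n t (B u))))) <= eps * h.
Proof.
  intros Hu Heps. pose proof (semigroup_regular X pos hX U hU hUs) as HU.
  destruct (iterate_bounded n) as (K & HK & HKb).
  destruct (iterate_bounded (S n)) as (K' & HK' & HKb').
  destruct B_bounded as (C & HC & HB).
  destruct (proj1 (filterlim_norm_iff (at_right 0) _ _) (generator_limit X U DA A hA u Hu)
    (eps / (2 * K'))) as [d1 Hd1]; [apply Rdiv_lt_0_compat; lra|].
  (* By the relative bound, [B (U s u) - B u] is controlled by [U s (u - A u) - (u - A u)]; the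
     factors [C] and [K] turn the tolerance into [eps / 4]. *)
  destruct (family_uniform U HU (minus u (A u)) (eps / (4 * (K * C)))) as (d2 & Hd2 & H2).
  { apply Rdiv_lt_0_compat; [lra|]. apply Rmult_lt_0_compat; [lra|].
    now apply Rmult_lt_0_compat. }
  destruct (family_uniform (V n) (iterate_regular n) (B u) (eps / 4))
    as (d3 & Hd3 & H3); [lra|].
  exists (Rmin d1 (Rmin d2 d3)). split.
  { apply Rmin_pos; [apply cond_pos|now apply Rmin_pos]. }
  intros t h Ht Hh.
  pose proof (Rmin_l d1 (Rmin d2 d3)). pose proof (Rmin_r d1 (Rmin d2 d3)).
  pose proof (Rmin_l d2 d3). pose proof (Rmin_r d2 d3).
  set (I := minus (V (S n) (t + h) u) (V (S n) t (U h u))).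
  assert (HI : norm (minus I (scal (h - 0) (V n t (B u)))) <= (h - 0) * (eps / 2)).
  { apply (norm_RInt_minus_const (fun s => V n (t + h - s) (B (U s u))) 0 h);
      [lra|apply iterate_shift; [exact Ht|lra|exact Hu]|].
    intros s Hs. destruct (domain_semigroup s u) as [HD HE]; [lra|exact Hu|].
    eapply Rle_trans; [apply (norm_minus_triangle _ (V n (t + h - s) (B u)))|].
    assert (norm (minus (V n (t + h - s) (B (U s u))) (V n (t + h - s) (B u))) <= eps / 4).
    { rewrite <- (linear_minus (V n (t + h - s))) by (apply V_linear; lra).
      eapply Rle_trans; [apply HKb; lra|].
      replace (eps / 4) with (K * (C * (eps / (4 * (K * C))))) by (field; lra).
      apply Rmult_le_compat_l; [lra|].
      rewrite <- linear_B_minus by assumption.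
      destruct (generator_minus X U DA A hU hA (U s u) u HD Hu) as [HDm HEm].
      eapply Rle_trans; [apply HB; exact HDm|]. apply Rmult_le_compat_l; [lra|].
      rewrite HEm, HE.
      specialize (H2 0 s (Rle_refl 0)). rewrite Rplus_0_l, (sg_zero X U hU) in H2.
      rewrite (linear_minus (U s)) in H2 by (apply U_linear; lra).
      apply Rlt_le. eapply Rle_lt_trans; [|apply H2; lra].
      apply Req_le. f_equal. vec. }
    specialize (H3 t (h - s) Ht). replace (t + (h - s)) with (t + h - s) in H3 by ring.
    assert (norm (minus (V n (t + h - s) (B u)) (V n t (B u))) < eps / 4)
      by (apply H3; lra).
    lra. }
  assert (HG : norm (minus (scal (/ h) (minus (U h u) u)) (A u)) < eps / (2 * K')).
  { apply Hd1; [|lra]. change (Rabs (h - 0) < d1). rewrite Rminus_0_r, Rabs_pos_eq; lra. }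
  replace (minus (minus (V (S n) (t + h) u) (V (S n) t u))
            (scal h (plus (V (S n) t (A u)) (V n t (B u))))) with
    (plus (minus I (scal (h - 0) (V n t (B u))))
       (scal h (V (S n) t (minus (scal (/ h) (minus (U h u) u)) (A u))))).
  - eapply Rle_trans; [apply norm_plus_le|].
    rewrite norm_scal_eq, (Rabs_pos_eq h) by lra.
    assert (norm (V (S n) t (minus (scal (/ h) (minus (U h u) u)) (A u))) <= eps / 2).
    { eapply Rle_trans; [apply HKb'; exact Ht|].
      replace (eps / 2) with (K' * (eps / (2 * K'))) by (field; lra).
      apply Rmult_le_compat_l; [lra|]. apply Rlt_le. exact HG. }
    assert (h * norm (V (S n) t (minus (scal (/ h) (minus (U h u) u)) (A u)))
            <= h * (eps / 2)) by (apply Rmult_le_compat_l; [lra|assumption]).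
    norm_lra.
  - assert (HV : is_linear (V (S n) t)) by (now apply V_linear).
    rewrite (linear_minus (V (S n) t)) by exact HV.
    rewrite (linear_scal (V (S n) t) HV), (linear_minus (V (S n) t)) by exact HV.
    unfold I. vec. all: field; lra.
Qed.

Lemma iterate_quotient_limit (n : nat) (u : X) (t : R) : DA u -> 0 <= t ->
  filterlim (fun h => scal (/ h) (minus (V (S n) (t + h) u) (V (S n) t u))) (at_right 0)
    (locally (plus (V (S n) t (A u)) (V n t (B u)))).
Proof.
  intros Hu Ht. apply filterlim_norm_iff; [exact _|]. intros eps Heps.
  destruct (iterate_difference n u (eps / 2) Hu) as (d & Hd & H); [lra|].
  exists (mkposreal d Hd). intros h Hh Hh0. change (Rabs (h - 0) < d) in Hh.
  rewrite Rminus_0_r, Rabs_pos_eq in Hh by lra.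
  specialize (H t h Ht (conj Hh0 Hh)).
  apply Rmult_lt_reg_l with h; [exact Hh0|].
  rewrite <- (Rabs_pos_eq h) at 1 by lra. rewrite <- norm_scal_eq.
  eapply Rle_lt_trans; [|apply Rle_lt_trans with (1 := H)].
  - apply Req_le. f_equal. vec; field; lra.
  - nra.
Qed.

Lemma iterate_derivative (n : nat) (u : X) (t : R) : DA u -> 0 < t ->
  is_derive (fun s => V (S n) s u) t (plus (V (S n) t (A u)) (V n t (B u))).
Proof.
  intros Hu Ht. set (D := fun s => plus (V (S n) s (A u)) (V n s (B u))).
  assert (HD : half_continuous D).
  { apply half_continuous_plus; apply regular_half_continuous; apply iterate_regular. }
  split; [apply is_linear_scal_l|]. intros x Hx.
  assert (x = t) as -> by (symmetry; exact (is_filter_lim_locally_unique t x Hx)).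
  intros eps. pose proof (cond_pos eps) as Heps.
  destruct (iterate_difference n u (eps / 2) Hu) as (d1 & Hd1 & H1); [lra|].
  destruct (proj1 (half_continuous_norm D) HD t (Rlt_le _ _ Ht) (eps / 2))
    as (d2 & Hd2 & H2); [lra|].
  assert (Hd : 0 < Rmin t (Rmin d1 d2)) by (apply Rmin_pos; [exact Ht|now apply Rmin_pos]).
  exists (mkposreal _ Hd). intros s Hs. change (Rabs (s - t) < Rmin t (Rmin d1 d2)) in Hs.
  pose proof (Rmin_l t (Rmin d1 d2)). pose proof (Rmin_r t (Rmin d1 d2)).
  pose proof (Rmin_l d1 d2). pose proof (Rmin_r d1 d2).
  change (norm (minus s t)) with (Rabs (s - t)). change (minus s t) with (s - t).
  destruct (Rtotal_order s t) as [Hst|[->|Hst]].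
  (* To the left of [t] the estimate is based at [s] and yields the slope [D s], which continuity
     compares with [D t]. *)
  - rewrite (Rabs_left (s - t)) in * by lra.
    specialize (H1 s (t - s) ltac:(lra) ltac:(lra)).
    replace (s + (t - s)) with t in H1 by ring. fold (D s) in H1.
    specialize (H2 s ltac:(lra)). rewrite (Rabs_left (s - t)) in H2 by lra.
    specialize (H2 ltac:(lra)). fold (D t).
    match goal with |- norm ?a <= _ =>
      assert (E : a = minus (scal (t - s) (minus (D t) (D s)))
        (minus (minus (V (S n) t u) (V (S n) s u)) (scal (t - s) (D s)))) by vec
    end.
    rewrite E. eapply Rle_trans; [apply norm_minus_le|].
    rewrite norm_scal_eq, (Rabs_pos_eq (t - s)) by lra. rewrite norm_minus_sym in H2.
    assert ((t - s) * norm (minus (D t) (D s)) <= (t - s) * (eps / 2))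
      by (apply Rmult_le_compat_l; lra).
    norm_lra.
  - match goal with |- norm ?a <= _ => assert (E : a = (zero : X)) by vec end.
    rewrite E, norm_zero_eq. apply Rmult_le_pos; [lra|apply Rabs_pos].
  - rewrite (Rabs_pos_eq (s - t)) in * by lra.
    specialize (H1 t (s - t) ltac:(lra) ltac:(lra)).
    rewrite Rplus_minus in H1.
    eapply Rle_trans; [exact H1|]. apply Rmult_le_compat_r; lra.
Qed.

(* The generator of the power series semigroup [\sum_n z^n V n t] is [A + z B]. *)
Lemma triangular_generator (w y : nat -> X) :
  (forall n, filterlim
    (fun h => scal (/ h) (minus (sum_n (fun k => V k h (w (n - k)%nat)) n) (w n)))
    (at_right 0) (locally (y n))) ->
  (DA (w 0%nat) /\ A (w 0%nat) = y 0%nat) /\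
  forall n, DA (w (S n)) /\ A (w (S n)) = minus (y (S n)) (B (w n)).
Proof.
  intros H.
  assert (H0 : DA (w 0%nat) /\ A (w 0%nat) = y 0%nat).
  { apply (generator_intro X U DA A hA).
    apply filterlim_ext_loc with (2 := H 0%nat).
    exists (mkposreal 1 Rlt_0_1). intros h _ Hh. rewrite sum_O. simpl Nat.sub.
    now rewrite (DP_zero X U DA B V hV) by lra. }
  assert (step : forall n, (forall k, (k <= n)%nat -> DA (w k)) ->
    DA (w (S n)) /\ A (w (S n)) = minus (y (S n)) (B (w n))).
  { intros n Hw.
    rewrite <- (sum_iterates_at_zero (fun k => B (w k)) n).
    apply (generator_intro X U DA A hA).
    (* Removing the terms of index [S k] leaves the term of index [0], that is, the difference
       quotient of [U] at [w (S n)]. The removed terms are increments from time [0], where [V (S k)]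
       vanishes. *)
    apply filterlim_ext_loc with (fun h => minus
      (scal (/ h) (minus (sum_n (fun k => V k h (w (S n - k)%nat)) (S n)) (w (S n))))
      (sum_n (fun k => scal (/ h) (minus (V (S k) (0 + h) (w (n - k)%nat))
                                         (V (S k) 0 (w (n - k)%nat)))) n)).
    - exists (mkposreal 1 Rlt_0_1). intros h _ Hh. rewrite sum_n_shift.
      rewrite (sum_n_scal_l (V := CompleteNormedModule.ModuleSpace R_AbsRing X)).
      rewrite (sum_n_ext (fun k => minus (V (S k) (0 + h) (w (n - k)%nat))
          (V (S k) 0 (w (n - k)%nat))) (fun k => V (S k) h (w (n - k)%nat))).
      + rewrite (DP_zero X U DA B V hV h) by lra. simpl Nat.sub.
        canonical_paths. vec.
      + intros k. rewrite Rplus_0_l, (iterate_at_zero (S k)). simpl. vec.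
    - apply filterlim_minus_fun; [exact _|apply H|].
      apply (filterlim_sum_n (at_right 0) (fun k h => scal (/ h)
        (minus (V (S k) (0 + h) (w (n - k)%nat)) (V (S k) 0 (w (n - k)%nat))))
        (fun k => V k 0 (B (w (n - k)%nat)))).
      intros k Hk.
      assert (HD : DA (w (n - k)%nat)) by (apply Hw; lia).
      (* At time [0] the part with [A] vanishes, its index [S k] being positive; only [V k 0 (B _)]
         remains. *)
      pose proof (iterate_quotient_limit k _ 0 HD (Rle_refl 0)) as Hlim.
      rewrite (iterate_at_zero (S k) (A _)) in Hlim. simpl initial_iterate in Hlim.
      rewrite plus_zero_l in Hlim. exact Hlim. }
  assert (Hall : forall n, (forall k, (k <= n)%nat -> DA (w k))).
  { induction n as [|n IH]; intros k Hk.
    - replace k with 0%nat by lia. apply H0.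
    - destruct (Nat.eq_dec k (S n)) as [->|Hne]; [now apply step|apply IH; lia]. }
  split; [exact H0|]. intros n. apply step, Hall.
Qed.

Lemma iterate_domain (u : X) (t : R) : DA u -> 0 <= t ->
  DA (V 0%nat t u) /\ A (V 0%nat t u) = U t (A u) /\
  forall n, DA (V (S n) t u) /\
    A (V (S n) t u) = minus (plus (V (S n) t (A u)) (V n t (B u))) (B (V n t u)).
Proof.
  intros Hu Ht. destruct (domain_semigroup t u Ht Hu) as [HD HE].
  rewrite (DP_zero X U DA B V hV) by exact Ht.
  split; [exact HD|]. split; [exact HE|].
  apply (triangular_generator (fun n => V n t u) (fun n => match n with
    | O => V 0%nat t (A u) | S m => plus (V (S m) t (A u)) (V m t (B u)) end)).
  intros n. apply filterlim_ext_loc with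
    (fun h => scal (/ h) (minus (V n (t + h) u) (V n t u))).
  - exists (mkposreal 1 Rlt_0_1). intros h _ Hh. f_equal. f_equal.
    (* The small time [h] has to be the outer one, as in [triangular_generator]. *)
    rewrite Rplus_comm. apply iterate_convolution_law; lra.
  - destruct n as [|n]; [|now apply iterate_quotient_limit].
    rewrite (DP_zero X U DA B V hV t (A u)) by exact Ht. rewrite <- HE.
    apply filterlim_ext_loc with (2 := generator_limit X U DA A hA _ HD).
    exists (mkposreal 1 Rlt_0_1). intros h _ Hh.
    rewrite !(DP_zero X U DA B V hV) by lra.
    rewrite <- (sg_plus X U hU) by lra. now rewrite Rplus_comm.
Qed.

(** * Laplace transforms and integrals of the iterates, continuity in the graph norm *)

Let orbit_continuous (n : nat) (u : X) : half_continuous (fun t => V n t u).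
Proof. apply regular_half_continuous, iterate_regular. Qed.

Lemma iterate_laplace (lambda : R) (u : X) (T : R) : 0 <= T ->
  let w n := laplace lambda (fun s => V n s u) T in
  let y n := minus (plus (scal lambda (w n)) (scal (exp (- lambda * T)) (V n T u)))
    (initial_iterate n u) in
  (DA (w 0%nat) /\ A (w 0%nat) = y 0%nat) /\
  forall n, DA (w (S n)) /\ A (w (S n)) = minus (y (S n)) (B (w n)).
Proof.
  intros HT w y. apply triangular_generator. intros n.
  apply filterlim_ext_loc with (fun h => scal (/ h)
    (minus (scal (exp (lambda * h)) (minus (laplace lambda (fun s => V n s u) (T + h))
       (laplace lambda (fun s => V n s u) h))) (w n))).
  - exists (mkposreal 1 Rlt_0_1). intros h _ Hh. f_equal. f_equal. symmetry.
    apply (laplace_convolution V n lambda u h T).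
    + intros k _. apply iterate_regular.
    + apply iterate_convolution_law.
    + lra.
    + exact HT.
  - apply (laplace_shift_quotient_limit lambda (fun s => V n s u)
      (fun h => laplace lambda (fun s => V n s u) (T + h))).
    + apply orbit_continuous.
    + apply iterate_at_zero.
    + apply (laplace_quotient_limit lambda (fun s => V n s u) T);
        [apply orbit_continuous|exact HT].
Qed.

Lemma iterate_laplace_limit (lambda : R) (u : X) (L : nat -> X) :
  (forall n, filterlim (laplace lambda (fun s => V n s u)) (Rbar_locally p_infty)
     (locally (L n))) ->
  let y n := minus (scal lambda (L n)) (initial_iterate n u) in
  (DA (L 0%nat) /\ A (L 0%nat) = y 0%nat) /\
  forall n, DA (L (S n)) /\ A (L (S n)) = minus (y (S n)) (B (L n)).
Proof.
  intros HL y.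
  destruct (triangular_generator L
    (fun n => minus (plus (scal lambda (L n)) (zero : X)) (initial_iterate n u)))
    as [[H0 E0] HS].
  - intros n. apply filterlim_ext_loc with (fun h => scal (/ h)
      (minus (scal (exp (lambda * h)) (minus (L n)
         (laplace lambda (fun s => V n s u) h))) (L n))).
    + exists (mkposreal 1 Rlt_0_1). intros h _ Hh. f_equal. f_equal. symmetry.
      apply (laplace_limit_convolution V n lambda u L h).
      * intros k _. apply iterate_regular.
      * apply iterate_convolution_law.
      * intros k _. apply HL.
      * lra.
    + apply (laplace_shift_quotient_limit lambda (fun s => V n s u) (fun _ => L n)).
      * apply orbit_continuous.
      * apply iterate_at_zero.
      * apply filterlim_ext with (fun _ => zero); [intros h; vec|apply filterlim_const].
  - split; [split; [exact H0|rewrite E0; unfold y; vec]|].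
    intros n. destruct (HS n) as [HD HE]. split; [exact HD|]. rewrite HE. unfold y. vec.
Qed.

(** The relative bound makes [B] continuous for the graph norm of [A]. The filter is arbitrary
    because both finite times and infinity occur. *)
Lemma perturbation_limit {T : Type} (F : (T -> Prop) -> Prop) {FF : Filter F}
    (f : T -> X) (l : X) :
  F (fun x => DA (f x)) -> DA l -> filterlim f F (locally l) ->
  filterlim (fun x => A (f x)) F (locally (A l)) ->
  filterlim (fun x => B (f x)) F (locally (B l)).
Proof.
  intros HF Hl Hf HAf. destruct B_bounded as (C & HC & HB).
  pose proof (filterlim_minus_fun F _ _ _ _ Hf HAf) as Hm.
  apply filterlim_norm_iff; [exact _|]. intros eps Heps.
  apply filterlim_norm_iff with (eps := eps / C) in Hm;
    [|exact _|now apply Rdiv_lt_0_compat].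
  generalize (filter_and _ _ HF Hm). apply filter_imp. intros x [HD Hx].
  rewrite <- linear_B_minus by assumption.
  destruct (generator_minus X U DA A hU hA (f x) l HD Hl) as [HDm HEm].
  eapply Rle_lt_trans; [apply HB; exact HDm|].
  replace eps with (C * (eps / C)) by (field; lra).
  apply Rmult_lt_compat_l; [exact HC|]. rewrite HEm.
  eapply Rle_lt_trans; [|exact Hx]. apply Req_le. f_equal. vec.
Qed.

Lemma perturbation_half_continuous (f : R -> X) :
  (forall t, 0 <= t -> DA (f t)) -> half_continuous f ->
  half_continuous (fun t => A (f t)) -> half_continuous (fun t => B (f t)).
Proof.
  intros HD Hf HAf t Ht.
  apply (perturbation_limit (within (Rle 0) (locally t)));
    [|now apply HD|now apply Hf|now apply HAf].
  exists (mkposreal 1 Rlt_0_1). intros s _ Hs. now apply HD.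
Qed.

(** Continuity climbs with [n]: [A (V (S n) t u)] contains [B (V n t u)], which is continuous as
    soon as [V n t u] and [A (V n t u)] are. *)
Lemma generator_iterate_continuous (n : nat) (u : X) : DA u ->
  half_continuous (fun t => A (V n t u)).
Proof.
  intros Hu. induction n as [|n IH].
  - apply half_continuous_ext with (fun t => U t (A u)).
    + intros t Ht. symmetry. now apply iterate_domain.
    + apply regular_half_continuous, (semigroup_regular X pos hX U hU hUs).
  - apply half_continuous_ext with
      (fun t => minus (plus (V (S n) t (A u)) (V n t (B u))) (B (V n t u))).
    + intros t Ht. symmetry. now apply iterate_domain.
    + apply half_continuous_minus.
      * apply half_continuous_plus; apply orbit_continuous.
      * apply perturbation_half_continuous; [|apply orbit_continuous|exact IH].
        intros t Ht. destruct (iterate_domain u t Hu Ht) as (H0 & _ & HS).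
        destruct n as [|n]; [exact H0|apply HS].
Qed.

Lemma laplace_0 (f : R -> X) (t : R) : laplace 0 f t = RInt f 0 t.
Proof.
  apply RInt_ext. intros s _. rewrite Ropp_0, Rmult_0_l, exp_0. vec.
Qed.

Lemma iterate_integral (u : X) (t : R) : 0 <= t ->
  (DA (RInt (fun s => V 0%nat s u) 0 t) /\
   A (RInt (fun s => V 0%nat s u) 0 t) = minus (V 0%nat t u) u) /\
  forall n, DA (RInt (fun s => V (S n) s u) 0 t) /\
    A (RInt (fun s => V (S n) s u) 0 t) =
    minus (V (S n) t u) (B (RInt (fun s => V n s u) 0 t)).
Proof.
  intros Ht. destruct (iterate_laplace 0 u t Ht) as [[H0 E0] HS].
  rewrite laplace_0 in H0. rewrite !laplace_0 in E0. split; [split; [exact H0|]|].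
  - rewrite E0, Ropp_0, Rmult_0_l, exp_0. simpl. vec.
  - intros n. destruct (HS n) as [HD HE]. rewrite !laplace_0 in HD, HE.
    split; [exact HD|]. rewrite HE, Ropp_0, Rmult_0_l, exp_0, laplace_0. simpl. vec.
Qed.

Lemma iterate_integral_domain (n : nat) (u : X) (t : R) : 0 <= t ->
  DA (RInt (fun s => V n s u) 0 t).
Proof.
  intros Ht. destruct (iterate_integral u t Ht) as [[H0 _] HS].
  destruct n; [exact H0|apply HS].
Qed.

(** The orbit is bounded by [K * norm u], so its integral is Lipschitz in [t] with that constant. *)
Lemma integral_half_continuous (n : nat) (u : X) :
  half_continuous (fun t => RInt (fun s => V n s u) 0 t).
Proof.
  destruct (iterate_bounded n) as (K & HK & Hbd).
  apply half_continuous_norm. intros t Ht eps Heps.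
  assert (HKu : 0 <= K * norm u) by (apply Rmult_le_pos; [lra|apply norm_ge_0]).
  exists (eps / (K * norm u + 1)). split; [apply Rdiv_lt_0_compat; lra|].
  intros s Hs Hst. rewrite <- !laplace_0.
  apply Rle_lt_trans with (Rabs (s - t) * (K * norm u)).
  - apply (norm_RInt_le_const_abs (fun s => scal (exp (- 0 * s)) (V n s u)) t s).
    + intros r Hr. rewrite Ropp_0, Rmult_0_l, exp_0, norm_scal_eq, Rabs_R1, Rmult_1_l.
      apply Hbd. apply Rle_trans with (2 := proj1 Hr). now apply Rmin_glb.
    + now apply laplace_minus; [apply orbit_continuous| |].
  - apply Rle_lt_trans with (Rabs (s - t) * (K * norm u + 1)).
    + apply Rmult_le_compat_l; [apply Rabs_pos|lra].
    + apply (Rmult_lt_compat_r (K * norm u + 1)) in Hst; [|lra].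
      replace (eps / (K * norm u + 1) * (K * norm u + 1)) with eps in Hst by (field; lra).
      exact Hst.
Qed.

Lemma generator_integral_continuous (n : nat) (u : X) :
  half_continuous (fun t => A (RInt (fun s => V n s u) 0 t)).
Proof.
  induction n as [|n IH].
  - apply half_continuous_ext with (fun t => minus (V 0%nat t u) u).
    + intros t Ht. symmetry. now apply iterate_integral.
    + apply half_continuous_minus; [apply orbit_continuous|].
      intros t _. apply filterlim_const.
  - apply half_continuous_ext with
      (fun t => minus (V (S n) t u) (B (RInt (fun s => V n s u) 0 t))).
    + intros t Ht. symmetry. now apply iterate_integral.
    + apply half_continuous_minus; [apply orbit_continuous|].
      apply perturbation_half_continuous;
        [intros; now apply iterate_integral_domain|apply integral_half_continuous|exact IH].
Qed.

(** The integral of the orbit is a positive vector of the domain, so dissipativity of [A + B]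
    applies to it, with the value of [A] already computed. *)
Lemma iterate_integral_dissipative (n : nat) (u : X) (t : R) : pos u -> 0 <= t ->
  Psi (B (RInt (fun s => V (S n) s u) 0 t)) <=
  - Psi (V (S n) t u) + Psi (B (RInt (fun s => V n s u) 0 t)).
Proof.
  intros Hu Ht. destruct (proj2 (iterate_integral u t Ht) n) as [HD HE].
  assert (Hpos : pos (RInt (fun s => V (S n) s u) 0 t)).
  { apply (is_RInt_in_cone pos (fun s => V (S n) s u) 0 t _ hX Ht).
    - intros s Hs. apply iterate_substochastic; [lra|exact Hu].
    - apply half_continuous_is_RInt; [apply orbit_continuous|lra|exact Ht]. }
  pose proof (hAB _ HD Hpos) as H.
  rewrite HE, (Psi_plus X pos Psi hPsi), (Psi_minus X pos Psi hPsi) in H. lra.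
Qed.

Section LaplaceLimit.
Context (lambda : R) (u : X) (L : nat -> X).
Hypothesis lambda_pos : 0 < lambda.
Hypothesis L_limit : forall n, filterlim (laplace lambda (fun s => V n s u))
  (Rbar_locally p_infty) (locally (L n)).

Let laplace_domain (n : nat) (t : R) : 0 <= t ->
  DA (laplace lambda (fun s => V n s u) t).
Proof.
  intros Ht. destruct (iterate_laplace lambda u t Ht) as [[H0 _] HS].
  destruct n; [exact H0|apply HS].
Qed.

Let limit_domain (n : nat) : DA (L n).
Proof.
  destruct (iterate_laplace_limit lambda u L L_limit) as [[H0 _] HS].
  destruct n; [exact H0|apply HS].
Qed.

(** The value of [A] at order [S n] involves [B] at order [n], which converges because the transform
    of order [n] already does so in the graph norm. *)
Lemma generator_laplace_converges (n : nat) :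
  filterlim (fun t => A (laplace lambda (fun s => V n s u) t)) (Rbar_locally p_infty)
    (locally (A (L n))).
Proof.
  destruct (iterate_laplace_limit lambda u L L_limit) as [[_ E0] ES].
  assert (Hy : forall m, filterlim (fun t => minus
      (plus (scal lambda (laplace lambda (fun s => V m s u) t))
         (scal (exp (- lambda * t)) (V m t u))) (initial_iterate m u))
    (Rbar_locally p_infty) (locally (minus (scal lambda (L m)) (initial_iterate m u)))).
  { intros m. destruct (iterate_bounded m) as (K & HK & Hbd).
    apply filterlim_minus_fun; [exact _| |apply filterlim_const].
    replace (scal lambda (L m)) with (plus (scal lambda (L m)) (zero : X)) by vec.
    apply filterlim_plus_fun; [exact _| |].
    - apply filterlim_scal_fun; [exact _|apply filterlim_const|apply L_limit].
    - apply (exp_decay_bounded lambda (K * norm u) (fun t => V m t u)); [exact lambda_pos|].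
      intros s Hs. now apply Hbd. }
  induction n as [|n IH].
  - rewrite E0. apply filterlim_ext_loc with (2 := Hy 0%nat).
    generalize p_infty_nonneg. apply filter_imp. intros t Ht. symmetry.
    now apply iterate_laplace.
  - rewrite (proj2 (ES n)).
    apply filterlim_ext_loc with (fun t => minus (minus
      (plus (scal lambda (laplace lambda (fun s => V (S n) s u) t))
         (scal (exp (- lambda * t)) (V (S n) t u))) (initial_iterate (S n) u))
      (B (laplace lambda (fun s => V n s u) t))).
    + generalize p_infty_nonneg. apply filter_imp. intros t Ht. symmetry.
      now apply iterate_laplace.
    + apply filterlim_minus_fun; [exact _|apply Hy|].
      apply perturbation_limit;
        [exact _| |apply limit_domain|apply L_limit|exact IH].
      generalize p_infty_nonneg. apply filter_imp. intros t Ht. now apply laplace_domain.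
Qed.

Lemma laplace_graph_integral (n : nat) :
  is_graph_integral X DA A (fun s => scal (exp (- lambda * s)) (V n s u)) (L n).
Proof.
  split; [|split; [apply limit_domain|]].
  - intros t Ht. split.
    + exists (laplace lambda (fun s => V n s u) t).
      apply is_RInt_laplace; [apply orbit_continuous|exact Ht].
    + now apply laplace_domain.
  - pose proof (proj1 (filterlim_norm_iff (Rbar_locally p_infty) _ _) (L_limit n)) as H1.
    pose proof (proj1 (filterlim_norm_iff (Rbar_locally p_infty) _ _)
      (generator_laplace_converges n)) as H2.
    apply (filterlim_locally (F := Rbar_locally p_infty)). intros eps.
    assert (He : 0 < eps / 2) by (pose proof (cond_pos eps); lra).
    generalize (filter_and _ _ p_infty_nonneg (filter_and _ _ (H1 _ He) (H2 _ He))).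
    apply filter_imp. intros t (Ht & Ha & Hb). unfold graph_norm.
    change (RInt (fun s => scal (exp (- lambda * s)) (V n s u)) 0 t) with
      (laplace lambda (fun s => V n s u) t).
    rewrite (proj2 (generator_minus X U DA A hU hA _ _ (laplace_domain n t Ht)
      (limit_domain n))).
    match goal with |- ball _ _ (?a + ?b) =>
      change (Rabs (a + b - 0) < eps);
      assert (0 <= a) by apply norm_ge_0; assert (0 <= b) by apply norm_ge_0 end.
    rewrite Rminus_0_r, Rabs_pos_eq by lra. lra.
Qed.

End LaplaceLimit.

(** The limits of all orders are chosen at once, since the identity at order [S n] refers to the
    limit at order [n]. No term in [u] appears, because [V (S n)] starts from [zero]. *)
Lemma iterate_graph_integral (u : X) (lambda : R) : 0 < lambda ->
  exists L : nat -> X,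
    (forall n, is_graph_integral X DA A
       (fun s => scal (exp (- lambda * s)) (V n s u)) (L n)) /\
    forall n, minus (scal lambda (L (S n))) (A (L (S n))) = B (L n).
Proof.
  intros Hl.
  destruct (choice (fun n l => filterlim (laplace lambda (fun s => V n s u))
    (Rbar_locally p_infty) (locally l))) as [L HL].
  { intros n. destruct (iterate_bounded n) as (K & HK & Hbd).
    apply (laplace_converges lambda (K * norm u)); [apply orbit_continuous|exact Hl|].
    intros s Hs. now apply Hbd. }
  exists L. split; [intros n; now apply laplace_graph_integral|].
  intros n. rewrite (proj2 (proj2 (iterate_laplace_limit lambda u L HL) n)). simpl. vec.
Qed.

End DysonPhillips.

Theorem proposition4p1
    (X : CompleteNormedModule R_AbsRing) (pos : X -> Prop)
    (hX : abstract_state_space X pos)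
    (Psi : X -> R) (hPsi : norm_functional X pos Psi)
    (U : R -> X -> X) (hU : C0_semigroup X U) (hUs : substochastic X pos U)
    (DA : X -> Prop) (A : X -> X) (hA : is_generator X U DA A)
    (B : X -> X) (hBlin : linear_on X DA B) (hBpos : positive_on X pos DA B)
    (hAB : forall u : X, DA u -> pos u -> Psi (plus (A u) (B u)) <= 0)
    (V : nat -> R -> X -> X) (hV : Dyson_Phillips X U DA B V)
    (n : nat) (hn : (1 <= n)%nat) :
  (* (1) *)
  (forall u : X, DA u -> forall t : R, 0 < t ->
     is_derive (fun s : R => V n s u) t
       (plus (V n t (A u)) (V (n - 1)%nat t (B u))) /\
     continuous (fun s : R => plus (V n s (A u)) (V (n - 1)%nat s (B u))) t) /\
  (* (2) *)
  (forall u : X, DA u ->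
     (forall t : R, 0 <= t ->
        DA (V n t u) /\ DA (V (n - 1)%nat t u) /\
        A (V n t u) =
          minus (plus (V n t (A u)) (V (n - 1)%nat t (B u)))
                (B (V (n - 1)%nat t u))) /\
     (forall t : R, 0 < t -> continuous (fun s : R => A (V n s u)) t)) /\
  (* (3) *)
  (forall u : X,
     (forall t : R, 0 <= t ->
        integral_in X DA (fun s : R => V n s u) 0 t /\
        integral_in X DA (fun s : R => V (n - 1)%nat s u) 0 t /\
        A (RInt (fun s : R => V n s u) 0 t) =
          minus (V n t u) (B (RInt (fun s : R => V (n - 1)%nat s u) 0 t))) /\
     (forall t : R, 0 < t ->
        continuous (fun r : R => A (RInt (fun s : R => V n s u) 0 r)) t)) /\
  (* (4) *)
  (forall (u : X) (t : R), pos u -> 0 <= t ->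
     Psi (B (RInt (fun s : R => V n s u) 0 t)) <=
       - Psi (V n t u) + Psi (B (RInt (fun s : R => V (n - 1)%nat s u) 0 t))) /\
  (* (5) *)
  (forall (u : X) (lambda : R), 0 < lambda ->
     exists I J : X,
       is_graph_integral X DA A
         (fun s : R => scal (exp (- lambda * s)) (V n s u)) I /\
       is_graph_integral X DA A
         (fun s : R => scal (exp (- lambda * s)) (V (n - 1)%nat s u)) J /\
       minus (scal lambda I) (A I) = B J).
Proof.
  (* From here on [n] stands for the former [n - 1]. *)
  destruct n as [|n]; [inversion hn|]. rewrite Nat.sub_succ, Nat.sub_0_r. clear hn.
  pose proof (iterate_regular X pos hX U DA A hU hUs hA Psi B hPsi hBlin hBpos hAB V hV)
    as Hreg.
  split; [|split; [|split; [|split]]].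
  - intros u Hu t Ht. split.
    + now apply (iterate_derivative X pos hX U DA A hU hUs hA Psi B).
    + apply (half_continuous_at (fun s => plus (V (S n) s (A u)) (V n s (B u))));
        [|exact Ht].
      apply half_continuous_plus; now apply regular_half_continuous.
  - intros u Hu. split.
    + intros t Ht. destruct (iterate_domain X pos hX U DA A hU hUs hA Psi B hPsi hBlin
        hBpos hAB V hV u t Hu Ht) as (H0 & _ & HS).
      destruct (HS n) as [HD HE]. split; [exact HD|]. split; [|exact HE].
      destruct n as [|n]; [exact H0|apply HS].
    + intros t Ht. apply (half_continuous_at (fun s => A (V (S n) s u))); [|exact Ht].
      now apply (generator_iterate_continuous X pos hX U DA A hU hUs hA Psi B).
  - intros u. split.
    + intros t Ht.
      assert (Hin : forall m, integral_in X DA (fun s => V m s u) 0 t).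
      { intros m. split.
        - apply half_continuous_ex_RInt;
            [now apply regular_half_continuous|apply Rle_refl|exact Ht].
        - now apply (iterate_integral_domain X pos hX U DA A hU hUs hA Psi B). }
      split; [apply Hin|]. split; [apply Hin|].
      now apply (iterate_integral X pos hX U DA A hU hUs hA Psi B).
    + intros t Ht.
      apply (half_continuous_at (fun r => A (RInt (fun s => V (S n) s u) 0 r)));
        [|exact Ht].
      now apply (generator_integral_continuous X pos hX U DA A hU hUs hA Psi B).
  - intros u t Hu Ht.
    now apply (iterate_integral_dissipative X pos hX U DA A hU hUs hA Psi B).
  - intros u lambda Hl.
    destruct (iterate_graph_integral X pos hX U DA A hU hUs hA Psi B hPsi hBlin hBpos hAB
      V hV u lambda Hl) as (L & HL & HE).
    exists (L (S n)), (L n). split; [apply HL|]. split; [apply HL|apply HE].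
Qed.
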